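(* Let $H(n)$ denote the minimum number of hyperplanes in $\mathbb{R}^n$ needed to dissect all edges of the hypercube graph $Q_n$. Then \[ H(n) \geq \Omega\left(n^{2/3} / \log(n)^{4/3}\right), \] i.e. there is a universal constant $c>0$ such that $H(n) \ge c\, n^{2/3}/\log(n)^{4/3}$ for all sufficiently large $n$.
   Context: The hypercube graph $Q_n$ has vertex set $\{-1,1\}^n \subset \mathbb{R}^n$, with an edge between $x,y$ whenever $\sum_{i=1}^n |x_i-y_i| = 2$ (the edge is the line segment between $x$ and $y$). A hyperplane dissects an edge if it intersects the edge but contains neither of its endpoints. $\log$ denotes the natural logarithm. *)

(* Defs.v *)
From HB Require Import structures.
From mathcomp Require Import all_boot all_order all_algebra.
From mathcomp Require Import all_classical all_reals all_analysis.

Set Implicit Arguments.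
Unset Strict Implicit.
Unset Printing Implicit Defensive.

Import Order.TTheory GRing.Theory Num.Theory.

Local Open Scope classical_set_scope.
Local Open Scope ring_scope.

Definition hyperplane (R : realType) (n : nat) (P : set 'rV[R]_n) : Prop :=
  exists (a : 'rV[R]_n) (b : R),
    a != 0 /\ P = [set x | \sum_(i < n) a 0 i * x 0 i = b].

Definition cube_vertex (R : realType) (n : nat) (x : 'rV[R]_n) : Prop :=
  forall i : 'I_n, x 0 i = -1 \/ x 0 i = 1.

Definition cube_edge (R : realType) (n : nat) (x y : 'rV[R]_n) : Prop :=
  [/\ cube_vertex x, cube_vertex y & \sum_(i < n) `|x 0 i - y 0 i| = 2].

Definition segment (R : realType) (n : nat) (x y : 'rV[R]_n) : set 'rV[R]_n :=
  [set z | exists2 t : R, 0 <= t <= 1 & z = (1 - t) *: x + t *: y].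

Definition dissects (R : realType) (n : nat) (P : set 'rV[R]_n) (x y : 'rV[R]_n) : Prop :=
  [/\ P `&` segment x y !=set0, ~ P x & ~ P y].

(* Repetitions in the family are harmless: only the least such k matters. *)
Definition dissectable_by (R : realType) (n k : nat) : Prop :=
  exists h : 'I_k -> set 'rV[R]_n,
    (forall j, hyperplane (h j)) /\
    (forall x y, cube_edge x y -> exists j, dissects (h j) x y).

Lemma dissectable_by_dim (R : realType) (n : nat) : dissectable_by R n n.
Proof.
exists (fun j => [set x : 'rV[R]_n | x 0 j = 0]); split=> [j|x y [xV yV xy2]].
  exists (delta_mx 0 j), 0; split.
    apply/eqP => /matrixP/(_ 0 j); rewrite !mxE !eqxx /= => /eqP.
    by rewrite oner_eq0.
  apply/seteqP; split=> x /=;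
    rewrite (bigD1 j) //= mxE !eqxx mul1r big1 ?addr0 // => i /negPf ij;
    by rewrite mxE eqxx ij mul0r.
have [j xyj] : exists j, x 0 j <> y 0 j.
  apply/existsNP => xy; move: xy2; rewrite big1 => [/esym/eqP|i _].
    by rewrite pnatr_eq0.
  by rewrite xy subrr normr0.
have yj : y 0 j = - x 0 j.
  case: (xV j) (yV j) xyj => -> [] -> //; by rewrite opprK.
have xj0 : x 0 j <> 0.
  case: (xV j) => -> /eqP; by rewrite ?oppr_eq0 oner_eq0.
exists j; split=> //=; last by rewrite yj => /eqP; rewrite oppr_eq0 => /eqP.
exists ((1 - 2^-1) *: x + 2^-1 *: y); split.
  rewrite /= !mxE yj mulrN -mulrBl.
  suff -> : 1 - 2^-1 - 2^-1 = 0 :> R by rewrite mul0r.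
  by rewrite {1}(splitr 1) div1r addrK subrr.
exists 2^-1 => //; rewrite invr_ge0 ler0n /=.
by rewrite invf_le1 ?ltr0n // ler1n.
Qed.

Fact dissectable_by_ex (R : realType) (n : nat) : exists k, `[< dissectable_by R n k >].
Proof. by exists n; apply/asboolP; exact: dissectable_by_dim. Qed.

Definition H (R : realType) (n : nat) : nat :=
  ex_minn (dissectable_by_ex R n).

(* Main.v *)
Require Import Defs.
From mathcomp Require Import all_boot all_order all_algebra.
From mathcomp Require Import all_classical all_reals all_analysis.
From mathcomp Require Import fintype finset ring lra zify.

Set Implicit Arguments.
Unset Strict Implicit.
Unset Printing Implicit Defensive.

Import Order.TTheory GRing.Theory Num.Theory.

Local Open Scope ring_scope.

(** Let the hyperplanes be [<v_j, x> = b_j], [j < k]. An edge at the vertex [x] in direction [i] is not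
    dissected as soon as [2 |v_ji| <= |<v_j, x> - b_j|] for all [j]; such [x] and [i] are found when
    [k^3 (ln n)^4 <= c n^2].

    Rescaling. Repeatedly delete a column that is heavy relative to the current row masses, and rescale
    a row whose remaining mass has dropped by a large constant factor, at most [T = O(ln n)] times per
    row. At most half of the columns are deleted, and on the set [G] of surviving ones the column sums
    of the normalised squares [v_ji^2 / s_j] are at most [tau = O(k T / n)].

    Rows rescaled [T] times. Their mass is spread over [T] geometrically decreasing scales, so for
    random signs outside [G] the probability that [<v_j, x> - b_j] is not large compared with the mass left on
    [G] is at most [n^O(1) (4/5)^T]; a union bound fixes the signs outside [G].

    Other rows. Bang's lemma gives a point [u = theta * sum_j eps_j w_j], [w_j] the normalised rows on
    [G], with [|<w_j, u> - b'_j| >= theta |w_j|^2] for all [j]; it lies in the cube if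
    [theta^2 k <= 1]. Rounding [u] to a vertex with vectors of column norm at most [1] costs [O(ln n)]
    (a deterministic potential-function walk), so [theta] of order [tau ln n] suffices. *)

(** * Averages over sign vectors *)

Section SignVectors.
Variables (R : realFieldType) (I : finType).
Implicit Types (f g : {ffun I -> bool} -> R) (x y : {ffun I -> bool}).

Definition sgb (b : bool) : R := if b then 1 else -1.

Lemma sgbN b : sgb (~~ b) = - sgb b.
Proof. by case: b; rewrite /= ?opprK. Qed.

Lemma sgb_sqr b : sgb b ^+ 2 = 1.
Proof. by case: b; rewrite /sgb ?sqrrN expr1n. Qed.

Lemma normr_sgb b : `|sgb b| = 1.
Proof. by case: b; rewrite /sgb ?normrN normr1. Qed.

Definition avg f : R := (\sum_x f x) / #|{ffun I -> bool}|%:R.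

Lemma card_signs_gt0 : 0 < #|{ffun I -> bool}|%:R :> R.
Proof. by rewrite ltr0n; apply/card_gt0P; exists [ffun=> true]. Qed.

Lemma avgD f g : avg (fun x => f x + g x) = avg f + avg g.
Proof. by rewrite /avg big_split /= mulrDl. Qed.

Lemma avgZ c f : avg (fun x => c * f x) = c * avg f.
Proof. by rewrite /avg -mulr_sumr mulrA. Qed.

Lemma avg_cst c : avg (fun=> c) = c.
Proof.
rewrite /avg sumr_const -[c *+ _]mulr_natr mulfK //.
by rewrite gt_eqF ?card_signs_gt0.
Qed.

Lemma avg_sum (J : finType) (F : J -> {ffun I -> bool} -> R) :
  avg (fun x => \sum_j F j x) = \sum_j avg (F j).
Proof. by rewrite /avg exchange_big /= mulr_suml. Qed.

Lemma eq_avg f g : f =1 g -> avg f = avg g.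
Proof. by move=> fg; rewrite /avg (eq_bigr g). Qed.

Lemma le_avg f g : (forall x, f x <= g x) -> avg f <= avg g.
Proof.
by move=> fg; rewrite /avg ler_pM2r ?invr_gt0 ?card_signs_gt0 // ler_sum.
Qed.

Lemma avg_lt_exists f c : avg f < c -> exists x, f x < c.
Proof.
move=> fc; apply/existsP; rewrite -[[exists _, _]]negbK negb_exists.
apply/negP => /forallP cf; move: fc; rewrite ltNge => /negP; apply.
by rewrite -[c]avg_cst; apply: le_avg => x; rewrite leNgt cf.
Qed.

Lemma avg_bij h f : bijective h -> avg (f \o h) = avg f.
Proof.
move=> [h' hK h'K]; rewrite /avg; congr (_ / _).
rewrite [RHS](reindex h) //=; exists h' => x _; [exact: hK|exact: h'K].
Qed.

Definition flip i x : {ffun I -> bool} := [ffun j => (j == i) (+) x j].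

Lemma flipK i : involutive (flip i).
Proof. by move=> x; apply/ffunP => j; rewrite !ffunE addKb. Qed.

Lemma avg_flip_odd i f : (forall x, f (flip i x) = - f x) -> avg f = 0.
Proof.
move=> fN; have := avg_bij f (inv_bij (flipK i)).
rewrite (@eq_avg (f \o flip i) (fun x => -1 * f x)); last first.
  by move=> x /=; rewrite fN mulN1r.
by rewrite avgZ; lra.
Qed.

Definition negv x : {ffun I -> bool} := [ffun j => ~~ x j].

Lemma negvK : involutive negv.
Proof. by move=> x; apply/ffunP => j; rewrite !ffunE negbK. Qed.

Definition mix (B : {set I}) x y : {ffun I -> bool} :=
  [ffun i => if i \in B then y i else x i].

(* Resampling the coordinates in [B] preserves the uniform distribution: the map
   [(x, y) |-> (mix B x y, mix B y x)] is an involution on pairs. *)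
Lemma avg_mix B f : avg f = avg (fun x => avg (fun y => f (mix B x y))).
Proof.
pose h (p : {ffun I -> bool} * {ffun I -> bool}) := (mix B p.1 p.2, mix B p.2 p.1).
have hK : involutive h.
  by move=> [x y]; rewrite /h /=; f_equal; apply/ffunP => i; rewrite !ffunE; case: (i \in B).
rewrite -[LHS]avg_cst /avg -!mulr_suml !pair_bigA /=; congr (_ / _ / _).
transitivity (\sum_(p : {ffun I -> bool} * {ffun I -> bool}) f p.2).
  by rewrite -(pair_bigA _ (fun _ y => f y)).
transitivity (\sum_(p : {ffun I -> bool} * {ffun I -> bool}) f p.1).
  rewrite -(pair_bigA _ (fun _ y => f y)) -(pair_bigA _ (fun x _ => f x)).
  by rewrite exchange_big.
by rewrite (reindex_inj (inv_inj hK)).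
Qed.

Definition walk (v : I -> R) (B : {set I}) x := \sum_(i in B) v i * sgb (x i).

Definition mass (v : I -> R) (B : {set I}) := \sum_(i in B) v i ^+ 2.

Lemma mass_ge0 v B : 0 <= mass v B.
Proof. by apply: sumr_ge0 => i _; exact: sqr_ge0. Qed.

Lemma massT v : mass v setT = \sum_i v i ^+ 2.
Proof. by apply: eq_bigl => i; rewrite inE. Qed.

Lemma mass_subset v (B C : {set I}) : B \subset C -> mass v B <= mass v C.
Proof.
move=> BC; rewrite /mass [leRHS](big_setID B) /= (setIidPr BC) lerDl.
exact: mass_ge0.
Qed.

Lemma walk_neg v B x : walk v B (negv x) = - walk v B x.
Proof.
by rewrite /walk -sumrN; apply: eq_bigr => i _; rewrite ffunE sgbN mulrN.
Qed.

(** Induction on the coordinates: flipping the new sign kills its odd powers. With [q] the old mass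
    and [w] the new square, the fourth moment grows by [6 q w + w^2], less than [3 q^2] does. *)
Lemma avg_walk_moments v B :
  avg (fun x => walk v B x ^+ 2) = mass v B /\
  avg (fun x => walk v B x ^+ 4) <= 3 * mass v B ^+ 2.
Proof.
rewrite /walk /mass.
suff H (s : seq I) : uniq s ->
    avg (fun x => (\sum_(i <- s) v i * sgb (x i)) ^+ 2) = \sum_(i <- s) v i ^+ 2 /\
    avg (fun x => (\sum_(i <- s) v i * sgb (x i)) ^+ 4)
      <= 3 * (\sum_(i <- s) v i ^+ 2) ^+ 2.
  have := H (enum B) (enum_uniq _); rewrite [\sum_(i <- _) _ ^+ 2]big_enum /=.
  rewrite (_ : avg _ = avg (fun x => (\sum_(i in B) v i * sgb (x i)) ^+ 2)).
    rewrite (_ : avg (fun x => _ ^+ 4) =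
      avg (fun x => (\sum_(i in B) v i * sgb (x i)) ^+ 4)) //.
    by apply: eq_avg => x; rewrite big_enum.
  by apply: eq_avg => x; rewrite big_enum.
elim: s => [_|a s IH /= /andP[as_ us]].
  rewrite !big_nil; split.
    under [LHS]eq_avg do rewrite big_nil expr0n.
    exact: avg_cst.
  rewrite (@eq_avg _ (fun=> 0)); last by move=> x; rewrite big_nil expr0n.
  by rewrite avg_cst expr0n mulr0.
have {IH us} [IH2 IH4] := IH us.
set Z := fun x : {ffun I -> bool} => \sum_(i <- s) v i * sgb (x i).
have Zflip x : Z (flip a x) = Z x.
  rewrite /Z !big_seq; apply: eq_bigr => i is_; rewrite ffunE.
  by case: eqVneq is_ as_ => // -> ->.
have aflip x : sgb (flip a x a) = - sgb (x a).
  by rewrite ffunE eqxx /= sgbN.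
have odd1 : avg (fun x => Z x * sgb (x a)) = 0.
  by apply: (@avg_flip_odd a) => x; rewrite Zflip aflip mulrN.
have odd3 : avg (fun x => Z x ^+ 3 * sgb (x a)) = 0.
  by apply: (@avg_flip_odd a) => x; rewrite Zflip aflip mulrN.
rewrite !big_cons; split.
  rewrite (@eq_avg _ (fun x => Z x ^+ 2 + (v a ^+ 2 + 2 * v a * (Z x * sgb (x a))))).
    by rewrite avgD avgD avg_cst avgZ odd1 mulr0 addr0 addrC IH2.
  move=> x; rewrite big_cons -/(Z x); have := sgb_sqr (x a).
  by move: (sgb _) => e e2; rewrite sqrrD exprMn e2; ring.
rewrite (@eq_avg _ (fun x => Z x ^+ 4 + (6 * v a ^+ 2 * Z x ^+ 2 + (v a ^+ 4 +
   (4 * v a * (Z x ^+ 3 * sgb (x a)) + 4 * v a ^+ 3 * (Z x * sgb (x a))))))).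
  rewrite !avgD avg_cst !avgZ odd1 odd3 IH2.
  move: IH4; set q := \sum_(i <- s) _; rewrite -/(Z _).
  have -> : v a ^+ 4 = (v a ^+ 2) ^+ 2 by rewrite -exprM.
  have := sqr_ge0 (v a); move: (v a ^+ 2) => w w0 le4.
  have := sqr_ge0 w; rewrite -/Z in le4 *; nra.
move=> x; rewrite big_cons -/(Z x); have := sgb_sqr (x a).
move: (sgb _) => e e2.
have e3 : e ^+ 3 = e by rewrite exprS e2 mulr1.
have e4 : e ^+ 4 = 1 by rewrite (exprM e 2 2) e2 expr1n.
transitivity (Z x ^+ 4 + 6 * v a ^+ 2 * Z x ^+ 2 * e ^+ 2 + v a ^+ 4 * e ^+ 4
  + 4 * v a * (Z x ^+ 3 * e) + 4 * v a ^+ 3 * (Z x * e ^+ 3)); first by ring.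
by rewrite e2 e3 e4; ring.
Qed.

End SignVectors.

(** * Anti-concentration along a chain of scales *)

Section AntiConcentration.
Variables (R : rcfType) (I : finType).
Implicit Types (Z : {ffun I -> bool} -> R).

(* This is [min 1 (r / |y|)], written so that it is [1] at [y = 0], where division would give [0]. *)
Definition prox (r y : R) : R := r / Num.max r `|y|.

Lemma prox_le1 r y : 0 < r -> prox r y <= 1.
Proof.
move=> r0; rewrite /prox ler_pdivrMr ?mul1r ?le_max ?lexx //.
by rewrite lt_max r0.
Qed.

Lemma avg_tail_half Z (a : R) : 0 <= a ->
  (forall F : R -> R, avg (F \o Z) = avg (fun x => F (- Z x))) ->
  avg (fun x => (a < Z x)%R%:R) <= 2^-1 :> R.
Proof.
move=> a0 /(_ (fun z => (a < z)%R%:R)) /= sym.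
suff : avg (fun x => (a < Z x)%R%:R) + avg (fun x => (a < - Z x)%R%:R) <= 1 :> R.
  by rewrite -sym; lra.
rewrite -avgD -[leRHS](avg_cst I); apply: le_avg => x.
by case: (ltP a (Z x)); case: (ltP a (- Z x)) => /= h1 h2; lra.
Qed.

Lemma avg_tail_chebyshev Z (a : R) : 0 < a ->
  (forall F : R -> R, avg (F \o Z) = avg (fun x => F (- Z x))) ->
  avg (fun x => (a < Z x)%R%:R) <= avg (fun x => Z x ^+ 2) / a ^+ 2 / 2 :> R.
Proof.
move=> a0 /(_ (fun z => (a < z)%R%:R)) /= sym.
suff : avg (fun x => (a < Z x)%R%:R) + avg (fun x => (a < - Z x)%R%:R)
    <= (a ^+ 2)^-1 * avg (fun x => Z x ^+ 2) by rewrite -sym; lra.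
rewrite -avgD -avgZ; apply: le_avg => x.
rewrite mulrC ler_pdivlMr ?exprn_gt0 //.
by case: (ltP a (Z x)); case: (ltP a (- Z x)); rewrite /= => h1 h2; nra.
Qed.

(* If [Z ^+ 2 <= c] then [3 s - Z ^+ 2 >= 3 s - c]; the second moment of
   [3 s - Z ^+ 2] is at most [6 s ^+ 2]. *)
Lemma avg_small_ball Z (s c : R) : 0 < s -> c < 3 * s ->
  avg (fun x => Z x ^+ 2) = s -> avg (fun x => Z x ^+ 4) <= 3 * s ^+ 2 ->
  avg (fun x => (Z x ^+ 2 <= c)%R%:R) <= 6 * s ^+ 2 / (3 * s - c) ^+ 2.
Proof.
move=> s0 cs EZ2 EZ4.
have cs0 : 0 < 3 * s - c by rewrite subr_gt0.
rewrite ler_pdivlMr ?exprn_gt0 //.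
apply: (@le_trans _ _ (avg (fun x => 9 * s ^+ 2 + (- 6 * s * Z x ^+ 2 + Z x ^+ 4)))).
  rewrite mulrC -avgZ; apply: le_avg => x.
  have -> : Z x ^+ 4 = (Z x ^+ 2) ^+ 2 by rewrite -exprM.
  case: (leP (Z x ^+ 2) c) => /= h.
    have : 0 <= (c - Z x ^+ 2) * ((3 * s - Z x ^+ 2) + (3 * s - c)).
      by rewrite mulr_ge0 //; lra.
    by lra.
  by have := sqr_ge0 (3 * s - Z x ^+ 2); lra.
by rewrite avgD avgD avg_cst avgZ EZ2; nra.
Qed.

(** With [M = max r |y|], the left [prox] is at most [2/25 * prox r y] unless [|y + Z| < M / 20].
    That event has probability at most [18/25 * prox r y]: by the small-ball bound if
    [|y| <= r / 4], by symmetry up to [|y| = r], by Chebyshev beyond. *)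
Lemma avg_prox_contract Z (y r r' s : R) :
  0 < r -> 0 < r' -> 250 * r' <= r -> 99 / 100 * r ^+ 2 <= s -> s <= r ^+ 2 ->
  (forall F : R -> R, avg (F \o Z) = avg (fun x => F (- Z x))) ->
  avg (fun x => Z x ^+ 2) = s -> avg (fun x => Z x ^+ 4) <= 3 * s ^+ 2 ->
  avg (fun x => prox r' (y + Z x)) <= 4 / 5 * prox r y.
Proof.
move=> r0 r'0 r'r rs sr sym EZ2 EZ4.
set M := Num.max r `|y|.
have rM : r <= M by rewrite le_max lexx.
have yM : `|y| <= M by rewrite le_max lexx orbT.
have M0 : 0 < M by apply: lt_le_trans rM.
have s0 : 0 < s by nra.
have le_ind x : prox r' (y + Z x) <= 2 / 25 * prox r y + (`|y + Z x| < M / 20)%R%:R.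
  have pr0 : 0 <= prox r y by rewrite /prox -/M divr_ge0 ?ltW.
  have [h|h] := ltP; first by have := prox_le1 (y + Z x) r'0; rewrite /=; lra.
  have m0 : 0 < Num.max r' `|y + Z x| by rewrite lt_max r'0.
  rewrite addr0 /prox -/M mulrA ler_pdivrMr // mulrAC ler_pdivlMr //.
  have : M / 20 <= Num.max r' `|y + Z x| by rewrite le_max h orbT.
  move: (Num.max _ _) m0 => m m0 Mm.
  have := mulr_ge0 (ltW m0) (_ : 0 <= r - 250 * r').
  have := mulr_ge0 (ltW r'0) (_ : 0 <= m - M / 20).
  by rewrite !subr_ge0 => /(_ Mm) ? /(_ r'r) ?; nra.
suff P : avg (fun x => (`|y + Z x| < M / 20)%R%:R) <= 18 / 25 * prox r y.
  apply: le_trans (le_avg le_ind) _.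
  by rewrite avgD avg_cst; lra.
have [yr|ry] := leP `|y| (r / 4).
  have -> : prox r y = 1.
    by rewrite /prox max_l ?divff ?gt_eqF //; lra.
  have ME : M = r by rewrite /M max_l //; lra.
  apply: (@le_trans _ _ (avg (fun x => (Z x ^+ 2 <= 9 / 100 * r ^+ 2)%R%:R))).
    apply: le_avg => x; rewrite ler_nat; case: ltP => //= h.
    suff -> : Z x ^+ 2 <= 9 / 100 * r ^+ 2 by [].
    move: h yr; rewrite ME !(ltr_norml, ler_norml) => /andP[? ?] /andP[? ?].
    by nra.
  apply: le_trans (avg_small_ball s0 _ EZ2 EZ4) _; first by nra.
  rewrite mulr1 ler_pdivrMr; last by rewrite exprn_gt0 //; nra.
  suff : 29 / 10 * s <= 3 * s - 9 / 100 * r ^+ 2 by move=> ?; nra.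
  by nra.
have {le_ind} P1 (a : R) : 0 <= a -> a <= `|y| - M / 20 ->
    avg (fun x => (`|y + Z x| < M / 20)%R%:R) <= avg (fun x => (a < Z x)%R%:R) :> R.
  move=> a0 ay; case: (ltP 0 y) => y0.
    rewrite (sym (fun z => (a < z)%R%:R)); apply: le_avg => x /=.
    rewrite ler_nat; case: ltP => //= h.
    suff -> : a < - Z x by [].
    by move: h ay; rewrite (gtr0_norm y0) ltr_norml => /andP[? ?]; lra.
  apply: le_avg => x; rewrite ler_nat; case: ltP => //= h.
  suff -> : a < Z x by [].
  by move: h ay; rewrite (ler0_norm y0) ltr_norml => /andP[? ?]; lra.
have [yr|{}ry] := leP `|y| r.
  have -> : prox r y = 1 by rewrite /prox max_l ?divff ?gt_eqF.
  have ME : M = r by rewrite /M max_l.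
  apply: le_trans (P1 0 (lexx _) _) _; first by rewrite ME; lra.
  by apply: le_trans (avg_tail_half (lexx _) sym) _; lra.
have ME : M = `|y| by rewrite /M max_r // ltW.
apply: le_trans (P1 (19 / 20 * M) _ _) _; [by lra|by rewrite ME; lra|].
apply: le_trans (avg_tail_chebyshev _ sym) _; first by lra.
rewrite EZ2 /prox -/M -mulrA -invfM ler_pdivrMr; last first.
  by rewrite mulr_gt0 // exprn_gt0 //; lra.
have -> : 18 / 25 * (r / M) * ((19 / 20 * M) ^+ 2 * 2)
   = 18 / 25 * (19 / 20) ^+ 2 * 2 * (r * M) * (M / M) by field; rewrite gt_eqF.
rewrite divff ?gt_eqF // mulr1.
have : r ^+ 2 <= r * M by rewrite expr2 ler_pM2l.
by nra.
Qed.

(** Masses dropping by [250 ^+ 2] mean radii dropping by [250], as [avg_prox_contract] requires;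
    [S :\: S'] then keeps over [99/100] of the mass. *)
Inductive mass_chain (v : I -> R) : nat -> {set I} -> Prop :=
| mass_chain0 : 0 < mass v setT -> mass_chain v 0 setT
| mass_chainS p (S S' : {set I}) : mass_chain v p S -> S' \subset S -> 0 < mass v S' ->
    250 ^+ 2 * mass v S' < mass v S -> mass_chain v p.+1 S'.

Lemma mass_chain_gt0 v p S : mass_chain v p S -> 0 < mass v S.
Proof. by case. Qed.

(** Passing from [S] to [S'] brings in the signs on [S :\: S']; resampling them with the other signs
    fixed gains one factor [4 / 5]. *)
Lemma avg_prox_chain v p S b : mass_chain v p S ->
  avg (fun x => prox (Num.sqrt (mass v S)) (walk v (~: S) x - b)) <= (4 / 5) ^+ p.
Proof.
elim=> [m0|{}p {}S S' chain IH S'S m'0 m'm].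
  rewrite expr0 -[leRHS](avg_cst I); apply: le_avg => x.
  by rewrite prox_le1 // sqrtr_gt0.
set r := Num.sqrt (mass v S) in IH *; set r' := Num.sqrt (mass v S').
have r'0 : 0 < r' by rewrite sqrtr_gt0.
have r0 : 0 < r by rewrite sqrtr_gt0 (mass_chain_gt0 chain).
have r2 : r ^+ 2 = mass v S by rewrite sqr_sqrtr ?mass_ge0.
have r'2 : r' ^+ 2 = mass v S' by rewrite sqr_sqrtr ?mass_ge0.
pose B := S :\: S'.
have massB : mass v S = mass v S' + mass v B.
  by rewrite /mass (big_setID S') /= (setIidPr S'S).
have walkB x y : walk v (~: S') (mix B x y) = walk v (~: S) x + walk v B y.
  rewrite /walk (big_setID (~: S)) /=; congr (_ + _).
    rewrite (setIidPr _) ?setCS //; apply: eq_bigr => i iS.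
    by rewrite ffunE inE (negPf (_ : i \notin S)) ?andbF // -in_setC.
  have -> : ~: S' :\: ~: S = B by rewrite setDE setCK setIC -setDE.
  by apply: eq_bigr => i iB; rewrite ffunE iB.
rewrite exprS (avg_mix B).
apply: le_trans (_ : 4 / 5 * avg (fun x => prox r (walk v (~: S) x - b)) <= _); last first.
  by apply: ler_wpM2l IH; lra.
rewrite -avgZ; apply: le_avg => x.
rewrite (eq_avg (g := fun y => prox r' (walk v (~: S) x - b + walk v B y))); last first.
  by move=> y; rewrite walkB addrAC.
have [E2 E4] := avg_walk_moments v B.
apply: (@avg_prox_contract (walk v B) _ r r' (mass v B)) => //.
- by rewrite -(ler_pXn2r (n := 2)) ?nnegrE ?mulr_ge0 ?ltW // exprMn r2 r'2; lra.
- by rewrite r2; have := mass_ge0 v S'; lra.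
- by rewrite r2; have := mass_ge0 v S'; lra.
- move=> F; rewrite -(avg_bij _ (inv_bij (@negvK I))); apply: eq_avg => y /=.
  by rewrite walk_neg.
Qed.

(** First-moment union bound: some [x] makes the sum of all [M * prox] less than [1], so
    [M * r < max r |y|] in each row, and [1 <= M] forces that maximum to be [|y|]. *)
Lemma exists_signs_far (J : finType) (v : J -> I -> R) (b : J -> R) (P : pred J)
    (p : nat) (S : J -> {set I}) (M : R) :
  (forall j, P j -> mass_chain (v j) p (S j)) -> 1 <= M ->
  #|J|%:R * (M * (4 / 5) ^+ p) < 1 ->
  exists x, forall j, P j ->
    M * Num.sqrt (mass (v j) (S j)) < `|walk (v j) (~: S j) x - b j|.
Proof.
move=> chain M1 JM; have M0 : 0 < M by lra.
pose f j x : R := if P j then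
  M * prox (Num.sqrt (mass (v j) (S j))) (walk (v j) (~: S j) x - b j) else 0.
have [x xP] : exists x, \sum_j f j x < 1.
  apply: avg_lt_exists; rewrite avg_sum; apply: le_lt_trans JM.
  rewrite mulr_natl -sumr_const; apply: ler_sum => j _.
  rewrite /f; case Pj : (P j).
    by rewrite avgZ; apply: ler_wpM2l (ltW M0) _ _ _; apply/avg_prox_chain/chain.
  by rewrite avg_cst mulr_ge0 ?(ltW M0) // exprn_ge0 //; lra.
exists x => j Pj; set r := Num.sqrt _.
have r0 : 0 < r by rewrite sqrtr_gt0 (mass_chain_gt0 (chain j Pj)).
have f0 i : 0 <= f i x.
  rewrite /f; case: ifP => // Pi; apply: mulr_ge0; first exact: ltW.
  by apply: divr_ge0; rewrite ?le_max sqrtr_ge0.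
have : f j x < 1.
  apply: le_lt_trans xP; rewrite [leRHS](bigD1 j) //= lerDl.
  by apply: sumr_ge0.
rewrite /f Pj /prox -/r mulrA ltr_pdivrMr; last by rewrite lt_max r0.
rewrite mul1r lt_max => /orP[|//].
have : r <= M * r by apply: ler_peMl (ltW r0) M1.
by rewrite leNgt => /negPf->.
Qed.

End AntiConcentration.

(** * Rescaling rows and deleting columns *)

Section Rescaling.
Variables (R : rcfType) (I J : finType) (v : J -> I -> R).
Variables (T : nat) (tau : R).
Hypothesis v_neq0 : forall j, 0 < mass (v j) setT.
Implicit Types (G : {set I}) (p : J -> nat) (S : J -> {set I}).

(* Row [j] is measured relative to its mass on [S j] and has been rescaled [p j] times. Each removed
   column accounts for at least [tau] of the total relative mass ever removed, and a row loses relative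
   mass at most [1] between two rescalings. *)
Record rescaled G p S : Prop := Rescaled {
  rescaled_chain : forall j, mass_chain (v j) (p j) (S j);
  rescaled_sub : forall j, G \subset S j;
  rescaled_le : forall j, (p j <= T)%N;
  rescaled_count : tau * #|~: G|%:R <=
    \sum_j ((p j)%:R + 1 - mass (v j) G / mass (v j) (S j)) }.

Lemma rescaled_card G p S : rescaled G p S -> tau * #|~: G|%:R <= #|J|%:R * T.+1%:R.
Proof.
case=> chain sub le /le_trans; apply.
rewrite mulr_natl -sumr_const; apply: ler_sum => j _.
have : 0 <= mass (v j) G / mass (v j) (S j) by rewrite divr_ge0 ?mass_ge0.
have : (p j)%:R <= T%:R :> R by rewrite ler_nat.
by rewrite -[T.+1]addn1 natrD; lra.
Qed.

(** Induction on [#|G| + \sum_j (T - p j)], which falls with every deletion and every rescaling;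
    when neither applies the conclusions hold. *)
Lemma exists_rescaled :
  exists G p S, [/\ rescaled G p S,
    forall i, i \in G -> \sum_j v j i ^+ 2 / mass (v j) (S j) <= tau &
    forall j, [\/ p j = T, mass (v j) G = 0 |
                mass (v j) (S j) <= 250 ^+ 2 * mass (v j) G]].
Proof.
suff H m G p S : (#|G| + \sum_j (T - p j) <= m)%N -> rescaled G p S ->
  exists G p S, [/\ rescaled G p S,
    forall i, i \in G -> \sum_j v j i ^+ 2 / mass (v j) (S j) <= tau &
    forall j, [\/ p j = T, mass (v j) G = 0 |
                mass (v j) (S j) <= 250 ^+ 2 * mass (v j) G]].
  apply: (H _ setT (fun=> 0%N) (fun=> setT) (leqnn _)); split=> // [j|].
    by constructor.
  rewrite setCT cards0 mulr0; apply: sumr_ge0 => j _.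
  by rewrite divff ?gt_eqF // add0r subrr.
elim: m G p S => [|m IH] G p S; first last.
  move=> Gm resc; have [chain sub le count] := resc.
  have [/existsP[i /andP[iG heavy]]|/existsPn light] := boolP [exists i, (i \in G) &&
      (tau < \sum_j v j i ^+ 2 / mass (v j) (S j))].
    (* Deleting [i] adds [tau] to the left of the count and the column sum, larger than [tau], to
       the right. *)
    apply: (IH (G :\ i) p S).
      by rewrite -ltnS; apply: leq_trans Gm; rewrite ltn_add2r (cardsD1 i G) iG.
    split=> // [j|]; first by rewrite (subset_trans _ (sub j)) ?subD1set.
    have -> : #|~: (G :\ i)| = #|~: G|.+1.
      by rewrite setCD setUC cardsU1 inE iG.
    rewrite -addn1 natrD mulrDr mulr1.
    apply: le_trans (lerD count (ltW heavy)) _; rewrite -big_split /=.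
    apply: ler_sum => j _; rewrite /mass [X in _ - X / _](big_setD1 i) //=.
    by rewrite mulrDl; lra.
  have [/existsP[j /and3P[pT m0 drop]]|/existsPn stay] := boolP [exists j, [&& (p j < T)%N,
      0 < mass (v j) G & 250 ^+ 2 * mass (v j) G < mass (v j) (S j)]].
    pose p' l := if l == j then (p j).+1 else p l.
    pose S' l := if l == j then G else S l.
    (* Rescaling resets the relative mass of row [j] to [1] and raises [p j] by one, so its term in
       the count does not decrease. *)
    apply: (IH G p' S').
      rewrite -ltnS; apply: leq_trans Gm; rewrite ltn_add2l.
      rewrite (bigD1 j) //= [X in (_ < X)%N](bigD1 j) //= /p' eqxx.
      rewrite (eq_bigr (fun l => (T - p l)%N)) => [|l /negPf-> //].
      by rewrite ltn_add2r ltn_sub2l.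
    split=> [l|l|l|]; rewrite /p' /S'.
    - case: eqVneq => [->|_]; last exact: chain.
      exact: mass_chainS (chain j) (sub j) m0 drop.
    - by case: ifP => _; rewrite ?subxx ?sub.
    - by case: ifP.
    - apply: le_trans count _; apply: ler_sum => l _.
      case: eqVneq => [->|_] //; rewrite divff ?gt_eqF // -[(p j).+1]addn1 natrD.
      have : 0 <= mass (v j) G / mass (v j) (S j) by rewrite divr_ge0 ?mass_ge0.
      by lra.
  exists G, p, S; split=> // [i iG|j].
    by have := light i; rewrite iG /= -leNgt.
  have := stay j; rewrite !negb_and -leqNgt -!leNgt => /or3P[Tp|m0|small].
  - by constructor 1; apply/eqP; rewrite eqn_leq le.
  - by constructor 2; apply/eqP; rewrite eq_le m0 mass_ge0.
  - by constructor 3.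
rewrite leqn0 addn_eq0 cards_eq0 => /andP[/eqP G0 /eqP sum0] resc.
exists G, p, S; split=> // [i|j]; first by rewrite G0 inE.
by constructor 2; rewrite G0 /mass big_set0.
Qed.

End Rescaling.

(** * Bang's lemma on points far from hyperplanes *)

Section Bang.
Variables (R : realFieldType) (I J : finType) (w : J -> I -> R) (b : J -> R).

(* The signs maximise [|u|^2 - 2 theta * sum_j eps_j b_j]; compare with flipping one of them. *)
Lemma Bang (theta : R) : 0 < theta ->
  exists e : {ffun J -> bool}, forall j,
    theta * mass (w j) setT <=
    `|\sum_i w j i * (theta * \sum_l sgb R (e l) * w l i) - b j|.
Proof.
move=> t0.
pose u (e : {ffun J -> bool}) i := theta * \sum_l sgb R (e l) * w l i.
pose Phi e := \sum_i u e i ^+ 2 - 2 * theta * \sum_l sgb R (e l) * b l.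
have [e _ emax] := @arg_maxP _ R _ [ffun=> true] xpredT Phi isT.
exists e => j; have := emax (flip j e) isT; rewrite -/(u e _).
set s := sgb R (e j).
have s2 : s ^+ 2 = 1 by exact: sgb_sqr.
have uflip i : u (flip j e) i = u e i - 2 * theta * s * w j i.
  rewrite /u (bigD1 j) //= [in RHS](bigD1 j) //= ffunE eqxx sgbN -/s.
  rewrite (eq_bigr (fun l => sgb R (e l) * w l i)) => [|l /negPf lj]; last by rewrite ffunE lj.
  by ring.
have bflip : \sum_l sgb R (flip j e l) * b l = \sum_l sgb R (e l) * b l - 2 * s * b j.
  rewrite (bigD1 j) //= [in RHS](bigD1 j) //= ffunE eqxx sgbN -/s.
  rewrite (eq_bigr (fun l => sgb R (e l) * b l)) => [|l /negPf lj]; last by rewrite ffunE lj.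
  by ring.
have sqflip : \sum_i u (flip j e) i ^+ 2 =
    \sum_i u e i ^+ 2 - 4 * theta * s * (\sum_i w j i * u e i) + 4 * theta ^+ 2 * mass (w j) setT.
  rewrite massT !mulr_sumr -sumrB -big_split /=; apply: eq_bigr => i _.
  rewrite uflip; transitivity (u e i ^+ 2 - 4 * theta * s * (w j i * u e i)
    + s ^+ 2 * (4 * theta ^+ 2 * w j i ^+ 2)); first by ring.
  by rewrite s2 mul1r.
rewrite /Phi /= bflip sqflip => h.
have {h} : theta * (theta * mass (w j) setT) <= theta * (s * (\sum_i w j i * u e i - b j)) by lra.
rewrite ler_pM2l // => /le_trans; apply; apply: le_trans (ler_norm _) _.
by rewrite normrM normr_sgb mul1r.
Qed.

End Bang.

(** * Logarithmic linear discrepancy *)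

Section Direction.
Variables (R : rcfType) (I : finType).
Implicit Types (A : {set I}) (F : finType) (y : I -> R).

Lemma exists_orthogonal A F (g : F -> I -> R) : (#|F| < #|A|)%N ->
  exists y, (exists2 i, i \in A & y i != 0) /\
    forall q, \sum_(i in A) g q i * y i = 0.
Proof.
move=> FA; pose M := \matrix_(a < #|A|, q < #|F|) g (enum_val q) (enum_val a).
pose z := nz_row (kermx M).
have zM : z *m M = 0 by apply/sub_kermxP/nz_row_sub.
have z0 : z != 0.
  rewrite nz_row_eq0 -mxrank_eq0 mxrank_ker subn_eq0 -ltnNge.
  exact: leq_ltn_trans (rank_leq_col _) FA.
pose y i := \sum_a (if enum_val a == i then z 0 a else 0).
have yE a : y (enum_val a) = z 0 a.
  rewrite /y (bigD1 a) //= eqxx big1 ?addr0 // => a' /negPf a'a.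
  by rewrite (inj_eq enum_val_inj) a'a.
exists y; split.
  have [a za] : exists a, z 0 a != 0.
    apply/existsP; apply: contraNT z0; rewrite negb_exists => /forallP z0.
    by apply/eqP/rowP => a; rewrite mxE; apply/eqP; have := z0 a; rewrite negbK.
  by exists (enum_val a); rewrite ?enum_valP ?yE.
move=> q; rewrite big_enum_val /=.
have /rowP/(_ (enum_rank q)) := zM; rewrite !mxE => zMq; rewrite -[RHS]zMq.
by apply: eq_bigr => a _; rewrite mxE enum_rankK yE mulrC.
Qed.

(** Gram-Schmidt: the next vector solves [#|F| + l] linear constraints, against all [g s] and all
    earlier [D * f q], in [#|A|] unknowns. *)
Lemma exists_orthonormal A F (g : F -> I -> R) (D : I -> R) (l : nat) :
  (forall i, i \in A -> 0 < D i) -> (l + #|F| <= #|A|)%N ->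
  exists f : nat -> I -> R, forall q, (q < l)%N ->
    (forall s, \sum_(i in A) g s i * f q i = 0) /\
    (forall q', (q' < l)%N -> \sum_(i in A) D i * f q i * f q' i = (q == q')%:R).
Proof.
move=> D0; elim: l => [|l IH] lA; first by exists (fun _ _ => 0).
have [f fP] := IH (ltnW lA).
pose g' (s : F + 'I_l) i := match s with inl s => g s i | inr q => D i * f q i end.
have [|y [[i0 i0A yi0] yP]] := @exists_orthogonal A (F + 'I_l)%type g'.
  by rewrite card_sum card_ord addnC.
pose N := \sum_(i in A) D i * y i ^+ 2.
have N0 : 0 < N.
  rewrite /N (bigD1 i0) //= ltr_pwDl //.
    by rewrite mulr_gt0 ?D0 // exprn_even_gt0.
  by apply: sumr_ge0 => i /andP[iA _]; rewrite mulr_ge0 ?sqr_ge0 ?ltW ?D0.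
pose c := Num.sqrt N; have c0 : c != 0 by rewrite gt_eqF ?sqrtr_gt0.
have c2 : c ^+ 2 = N by rewrite sqr_sqrtr ?ltW.
have yg s : \sum_(i in A) g s i * (y i / c) = 0.
  under eq_bigr do rewrite mulrA.
  by rewrite -mulr_suml (yP (inl s)) mul0r.
have yf q : (q < l)%N -> \sum_(i in A) D i * f q i * (y i / c) = 0.
  move=> ql; under eq_bigr do rewrite mulrA.
  by rewrite -mulr_suml (yP (inr (Ordinal ql))) mul0r.
exists (fun q => if (q < l)%N then f q else fun i => y i / c) => q ql.
have [{}ql|lq] := ltnP q l.
  have [fg ff] := fP q ql; split=> // q' q'l; have [{}q'l|lq'] := ltnP q' l.
    exact: ff.
  by rewrite yf // ltn_eqF // (leq_trans ql).
split=> // q' q'l; have [{}q'l|lq'] := ltnP q' l.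
  rewrite gtn_eqF ?(leq_trans q'l) // -[RHS](yf q' q'l); apply: eq_bigr => i _.
  by rewrite mulrAC.
have -> : q = q' by apply/eqP; rewrite eqn_leq; move: ql q'l; rewrite !ltnS => ? ?;
  rewrite !(leq_trans _ lq) ?(leq_trans _ lq').
rewrite eqxx /= -(divff (_ : c ^+ 2 != 0)) ?expf_neq0 // {1}c2 /N mulr_suml.
by apply: eq_bigr => i _; field.
Qed.

Lemma Bessel A (D : I -> R) (l : nat) (f : nat -> I -> R) (h : I -> R) :
  (forall i, i \in A -> 0 < D i) ->
  (forall q q', (q < l)%N -> (q' < l)%N -> \sum_(i in A) D i * f q i * f q' i = (q == q')%:R) ->
  \sum_(q < l) (\sum_(i in A) h i * f q i) ^+ 2 <= \sum_(i in A) h i ^+ 2 / D i.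
Proof.
move=> D0 ff; pose s q := \sum_(i in A) h i * f q i.
pose z i := \sum_(q < l) s q * f q i.
have hz : \sum_(i in A) h i * z i = \sum_(q < l) s q ^+ 2.
  under eq_bigr do rewrite /z mulr_sumr.
  rewrite exchange_big /=; apply: eq_bigr => q _.
  by rewrite expr2 {2}/s mulr_sumr; apply: eq_bigr => i _; rewrite mulrCA.
have zz : \sum_(i in A) D i * z i ^+ 2 = \sum_(q < l) s q ^+ 2.
  transitivity (\sum_(q < l) s q * \sum_(i in A) D i * f q i * z i).
    under eq_bigr do rewrite expr2 {1}/z mulr_suml mulr_sumr.
    rewrite exchange_big /=; apply: eq_bigr => q _.
    by rewrite mulr_sumr; apply: eq_bigr => i _; ring.
  apply: eq_bigr => q _; rewrite expr2; congr (_ * _).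
  under eq_bigr do rewrite /z mulr_sumr.
  rewrite exchange_big /= (bigD1 q) //= [X in _ + X]big1 ?addr0.
    under eq_bigr do rewrite mulrCA.
    by rewrite -mulr_sumr ff // eqxx mulr1.
  move=> q' q'q; under eq_bigr do rewrite mulrCA.
  by rewrite -mulr_sumr ff // eq_sym (inj_eq val_inj) (negPf q'q) mulr0.
have : 0 <= \sum_(i in A) D i * (h i / D i - z i) ^+ 2.
  by apply: sumr_ge0 => i iA; rewrite mulr_ge0 ?sqr_ge0 ?ltW ?D0.
rewrite (eq_bigr (fun i => h i ^+ 2 / D i + (D i * z i ^+ 2 - 2 * (h i * z i)))).
  rewrite big_split /= sumrB -mulr_sumr hz zz /s; lra.
by move=> i iA; have /gt_eqF/negbT := D0 i iA => ?; field.
Qed.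

(* A trace bound: an orthonormal basis (for the weights [D]) of the space killed by [g] has at least
   [#|A| / 2] elements, and by Bessel's inequality the quadratic forms on the left sum up to at most
   [#|A|] over it. *)
Lemma exists_balanced_direction A F (g : F -> I -> R) (J : finType) (v : J -> I -> R) (W : J -> R) :
  (0 < #|A|)%N -> (2 * #|F| <= #|A|)%N -> (forall j, 0 <= W j) ->
  (forall i, i \in A -> 0 < \sum_j W j * v j i ^+ 2) ->
  exists y, [/\ forall i, i \notin A -> y i = 0, \sum_i y i ^+ 2 = 1,
    forall s, \sum_i g s i * y i = 0 &
    \sum_j W j * (\sum_i v j i * y i) ^+ 2 <= 2 * \sum_j W j * \sum_i v j i ^+ 2 * y i ^+ 2].
Proof.
move=> A0 FA W0; set D := fun i => \sum_j W j * v j i ^+ 2 => D0.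
pose l := (#|A| - #|F|)%N.
have lF : (l + #|F| <= #|A|)%N by rewrite subnK // (leq_trans _ FA) // leq_pmull.
have [f fP] := @exists_orthonormal A F g D l D0 lF.
pose Q q := \sum_j W j * (\sum_(i in A) v j i * f q i) ^+ 2.
have sumQ : \sum_(q < l) Q q <= #|A|%:R.
  rewrite /Q exchange_big /=.
  apply: (@le_trans _ _ (\sum_j W j * \sum_(i in A) v j i ^+ 2 / D i)).
    apply: ler_sum => j _; rewrite -mulr_sumr ler_wpM2l //.
    by apply: Bessel => // q q' ql q'l; have [_ ->] := fP q ql.
  under eq_bigr do rewrite mulr_sumr.
  rewrite exchange_big /= -sumr_const; apply: ler_sum => i iA.
  under eq_bigr do rewrite mulrA.
  by rewrite -mulr_suml divff ?gt_eqF ?D0.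
have [q Qq] : exists q : 'I_l, Q q <= 2.
  apply/existsP; rewrite -[X in is_true X]negbK negb_exists; apply/negP => /forallP Q2.
  have : \sum_(q < l) 2 < \sum_(q < l) Q q.
    apply: ltr_sum => [|q _]; last by rewrite ltNge Q2.
    apply/hasP; have l0 : (0 < l)%N by rewrite subn_gt0; lia.
    by exists (Ordinal l0); rewrite ?mem_index_enum.
  rewrite ltNge => /negP; apply; apply: le_trans sumQ _.
  rewrite sumr_const card_ord -[2 *+ l]mulr_natr -natrM ler_nat /l; lia.
have [fg ff] := fP q (ltn_ord q).
pose N := \sum_(i in A) f q i ^+ 2.
have N0 : 0 < N.
  have N0 : 0 <= N by apply: sumr_ge0 => i _; exact: sqr_ge0.
  rewrite lt_def N0 andbT; apply/eqP => /eqP; rewrite psumr_eq0; last by move=> i _; exact: sqr_ge0.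
  move=> /allP f0; have := ff q (ltn_ord q); rewrite eqxx big1; last first.
    by move=> i iA; have := f0 i (mem_index_enum _); rewrite iA /= sqrf_eq0 => /eqP->; rewrite mulr0.
  by move/eqP; rewrite eq_sym oner_eq0.
pose c := Num.sqrt N; have c0 : c != 0 by rewrite gt_eqF ?sqrtr_gt0.
have c2 : c ^+ 2 = N by rewrite sqr_sqrtr ?ltW.
pose y i := if i \in A then f q i / c else 0.
have dot (h : I -> R) : \sum_i h i * y i = (\sum_(i in A) h i * f q i) / c.
  rewrite mulr_suml [RHS]big_mkcond /=; apply: eq_bigr => i _.
  by rewrite /y; case: ifP => _; rewrite ?mulr0 ?mulrA.
have dot2 (h : I -> R) : \sum_i h i * y i ^+ 2 = (\sum_(i in A) h i * f q i ^+ 2) / c ^+ 2.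
  rewrite mulr_suml [RHS]big_mkcond /=; apply: eq_bigr => i _.
  by rewrite /y; case: ifP => _; rewrite ?expr0n ?mulr0 // expr_div_n mulrA.
exists y; split=> [i /negPf iA||s|]; first by rewrite /y iA.
- under eq_bigr do rewrite -[_ ^+ 2]mul1r.
  rewrite dot2; under eq_bigr do rewrite mul1r.
  by rewrite c2 divff ?gt_eqF.
- by rewrite dot fg mul0r.
have -> : \sum_j W j * (\sum_i v j i * y i) ^+ 2 = Q q / c ^+ 2.
  by rewrite /Q mulr_suml; apply: eq_bigr => j _; rewrite dot expr_div_n mulrA.
have -> : \sum_j W j * \sum_i v j i ^+ 2 * y i ^+ 2 = (c ^+ 2)^-1.
  under eq_bigr do rewrite dot2 mulrA.
  rewrite -mulr_suml -[RHS]mul1r; congr (_ * _).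
  under eq_bigr do rewrite mulr_sumr.
  transitivity (\sum_(i in A) D i * f q i * f q i); last by rewrite ff // eqxx.
  rewrite exchange_big /=; apply: eq_bigr => i _; rewrite /D -mulrA -expr2 mulr_suml.
  by apply: eq_bigr => j _; rewrite mulrA.
by rewrite ler_pM2r // invr_gt0 exprn_even_gt0.
Qed.

End Direction.

(** * The potential-function walk and rounding to signs *)

Section Discrepancy.
Variable R : realType.

(** Invert [1 - z <= expR (- z)] and use [(1 - z) * (1 + z + 2 z^2) = 1 + z^2 (1 - 2 z)]. *)
Lemma expR_le_quad (z : R) : z <= 1 / 2 -> expR z <= 1 + z + 2 * z ^+ 2.
Proof.
move=> z2; have z1 : 0 < 1 - z by lra.
have : 1 - z <= expR (- z) by rewrite expR_ge1Dx.
rewrite expRN -[leLHS]invrK lef_pV2 ?posrE ?invr_gt0 ?expR_gt0 // => /le_trans; apply.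
rewrite -[leLHS]mul1r ler_pdivrMr //; have := sqr_ge0 z => z0.
have : 0 <= z ^+ 2 * (1 - 2 * z) by rewrite mulr_ge0 //; lra.
by lra.
Qed.

(** The terms linear in [a] cancel; the last hypothesis absorbs [4 a^2 eta^2], and [b <= 64^-1]
    makes [b^2 eta^4] small next to [b eta^2]. *)
Lemma expR_sym_step (a b d eta : R) : 0 <= b <= 64^-1 -> 0 < eta -> eta <= 1 ->
  `|a| * eta <= 1 / 2 -> 2 * a ^+ 2 <= d + b / 4 ->
  expR (a * eta - b * eta ^+ 2) + expR (- (a * eta) - b * eta ^+ 2)
    <= 2 + 2 * eta ^+ 2 * (d - b / 2).
Proof.
move=> /andP[b0 b1] eta0 eta1 an a2.
have e20 : 0 <= eta ^+ 2 by exact: sqr_ge0.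
have e21 : eta ^+ 2 <= 1 by rewrite exprn_ile1 // ltW.
have be0 : 0 <= b * eta ^+ 2 by exact: mulr_ge0.
have be1 : b * eta ^+ 2 <= 64^-1.
  by apply: le_trans b1; rewrite ler_piMr.
move: an; rewrite -[in `|a| * eta](gtr0_norm eta0) -normrM ler_norml => /andP[an1 an2].
have z1 : a * eta - b * eta ^+ 2 <= 1 / 2 by lra.
have z2 : - (a * eta) - b * eta ^+ 2 <= 1 / 2 by lra.
apply: le_trans (lerD (expR_le_quad z1) (expR_le_quad z2)) _.
have : 0 <= eta ^+ 2 * (d + b / 4 - 2 * a ^+ 2) by rewrite mulr_ge0 // subr_ge0.
have : 0 <= (b * eta ^+ 2) * (64^-1 - b * eta ^+ 2) by rewrite mulr_ge0 // subr_ge0.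
by clear -be0; lra.
Qed.

(** An instance of [(p - q)^2 <= 2 p^2 + 2 q^2], shaped for the last hypothesis of
    [expR_sym_step]. *)
Lemma slope_sq_le (d X B : R) : X ^+ 2 <= 4 * B ->
  2 * (64^-1 * d - 2 / 256 * X) ^+ 2 <= 1024^-1 * d ^+ 2 + 256^-1 * B / 4.
Proof. by have := sqr_ge0 (64^-1 * d + 2 / 256 * X); lra. Qed.

Section Walk.
Variables (I J : finType) (v : J -> I -> R) (u : I -> R).
Hypothesis col_le1 : forall i, \sum_j v j i ^+ 2 <= 1.
(** Such a row is always small, so each coordinate carries positive weight, as
    [exists_balanced_direction] demands. *)
Hypothesis singleton_row : forall i, exists j, v j i != 0 /\ forall l, l != i -> v j l = 0.
Hypothesis u_le1 : forall i, `|u i| <= 1.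
Implicit Types (A : {set I}) (x y : I -> R).

Let n : R := #|I|%:R.
(** The step length: it keeps alive coordinates in the cube, and [n * eta <= 1] bounds the total
    cost of rounding the others. *)
Let eta : R := (n + 1)^-1.
Let dev x j := \sum_i v j i * (x i - u i).
Let alive x := [set i | `|x i| < 1 - eta].
Let small A j := mass (v j) A <= 4.
Let energy A x j := \sum_(i in A) v j i ^+ 2 * (1 - x i ^+ 2).
(* As [x] moves along a direction orthogonal to it, the loss of energy pays for the second-order growth
   of [expR]; a row that is not small is kept at deviation [0], and [expR 64^-1] bounds the weight it
   has when it becomes small. *)
Let weight A x j := expR (64^-1 * dev x j + 256^-1 * energy A x j).
Let pot A x j := if small A j then weight A x j else expR 64^-1.

Let n_ge0 : 0 <= n. Proof. exact: ler0n. Qed.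
Let n1_gt0 : 0 < n + 1. Proof. exact: ltr_wpDl. Qed.
Let eta_gt0 : 0 < eta. Proof. by rewrite /eta invr_gt0. Qed.
Let eta_le1 : eta <= 1. Proof. by rewrite /eta invf_le1 ?lerDr. Qed.
Let eta_n : eta * (n + 1) = 1. Proof. by rewrite mulVf ?gt_eqF. Qed.

Let entry_sq_le1 j i : v j i ^+ 2 <= 1.
Proof.
apply: le_trans (col_le1 i); rewrite (bigD1 j) //= lerDl.
by apply: sumr_ge0 => l _; exact: sqr_ge0.
Qed.

Let entry_le1 j i : `|v j i| <= 1.
Proof. by rewrite -(ler_pXn2r (n := 2)) ?nnegrE // real_normK ?num_real // expr1n. Qed.

Let sq_le1 (a : R) : `|a| <= 1 -> a ^+ 2 <= 1.
Proof. by move=> a1; rewrite -real_normK ?num_real // exprn_ile1. Qed.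

Let walk_inv x := [/\ forall i, `|x i| <= 1, forall j, ~~ small (alive x) j -> dev x j = 0 &
  \sum_j pot (alive x) x j <= #|J|%:R * expR 64^-1].

Let energy_le A x j : (forall i, `|x i| <= 1) -> 0 <= energy A x j <= mass (v j) A.
Proof.
move=> x1; apply/andP; split.
  by apply: sumr_ge0 => i _; rewrite mulr_ge0 ?sqr_ge0 // subr_ge0 sq_le1.
apply: ler_sum => i _; rewrite ler_piMr ?sqr_ge0 //.
by have := sqr_ge0 (x i); lra.
Qed.

(** Freezing coordinates only lowers the energy. A row that turns small has deviation [0] and energy
    at most [4], and [4 / 256 = 1 / 64]. *)
Let pot_subset A (B : {set I}) x j : B \subset A -> (forall i, `|x i| <= 1) ->
  (~~ small A j -> dev x j = 0) -> pot B x j <= pot A x j.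
Proof.
move=> BA x1 dev0; have mBA := mass_subset (v j) BA.
rewrite /pot; case: (boolP (small A j)) => sA.
  have -> : small B j by apply: le_trans mBA sA.
  rewrite /weight ler_expR; suff : energy B x j <= energy A x j by lra.
  rewrite /energy [leRHS](big_setID B) /= (setIidPr BA) lerDl.
  by apply: sumr_ge0 => i _; rewrite mulr_ge0 ?sqr_ge0 // subr_ge0 sq_le1.
case: ifP => // sB; rewrite /weight ler_expR dev0 //.
have /andP[_] := energy_le B j x1; move: sB; rewrite /small; lra.
Qed.

(** Double counting: the column bounds limit the total mass on [A] to [#|A|]. *)
Let count_big A : (4 * #|[pred j | ~~ small A j]| <= #|A|)%N.
Proof.
rewrite -(ler_nat R) natrM.
apply: (@le_trans _ _ (\sum_j mass (v j) A)).
  rewrite (bigID (small A)) /= ler_wpDl ?sumr_ge0 // => [j _|]; first exact: mass_ge0.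
  rewrite mulr_natr -sumr_const; apply: ler_sum => j.
  by rewrite inE /small -ltNge => /ltW.
rewrite exchange_big /= -sumr_const; apply: ler_sum => i _; exact: col_le1.
Qed.

(** Moving by [t * y] multiplies the weight by [expR (a * t - b * t ^+ 2)], the quadratic term
    coming from the energy; [expR_sym_step] adds the cases [t = eta] and [t = - eta]. *)
Let pot_step A x y j :
  (forall i, `|x i| <= 1) -> (forall i, i \notin A -> y i = 0) -> (forall i, `|y i| <= 1) ->
  (~~ small A j -> \sum_i v j i * y i = 0) ->
  pot A (fun i => x i + eta * y i) j + pot A (fun i => x i - eta * y i) j <=
  2 * pot A x j + 2 * eta ^+ 2 * ((if small A j then weight A x j else 0) *
    (1024^-1 * (\sum_i v j i * y i) ^+ 2 - 512^-1 * \sum_i v j i ^+ 2 * y i ^+ 2)).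
Proof.
move=> x1 yA y1 bigj; rewrite /pot.
case: ifP => [sj|_]; last by rewrite mul0r; lra.
set dot := \sum_i v j i * y i; set B := \sum_i v j i ^+ 2 * y i ^+ 2.
pose X := \sum_(i in A) v j i ^+ 2 * (x i * y i).
have BE : B = \sum_(i in A) v j i ^+ 2 * y i ^+ 2.
  rewrite /B (bigID (mem A)) /= [X in _ + X]big1 ?addr0 // => i /yA->.
  by rewrite expr0n mulr0.
have B0 : 0 <= B by apply: sumr_ge0 => i _; rewrite mulr_ge0 ?sqr_ge0.
have B4 : B <= 4.
  apply: le_trans sj; rewrite BE; apply: ler_sum => i _.
  by rewrite ler_piMr ?sqr_ge0 // sq_le1.
(* Cauchy-Schwarz, using that the mass on [A] is at most [4]. *)
have X2 : X ^+ 2 <= 4 * B.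
  have : 0 <= \sum_(i in A) v j i ^+ 2 * (y i - X / 4 * x i) ^+ 2.
    by apply: sumr_ge0 => i _; rewrite mulr_ge0 ?sqr_ge0.
  have -> : \sum_(i in A) v j i ^+ 2 * (y i - X / 4 * x i) ^+ 2 =
      B - X / 2 * X + (X / 4) ^+ 2 * \sum_(i in A) v j i ^+ 2 * x i ^+ 2.
    rewrite BE {3}/X !mulr_sumr -sumrB -big_split /=.
    by apply: eq_bigr => i _; field.
  have : \sum_(i in A) v j i ^+ 2 * x i ^+ 2 <= 4.
    apply: le_trans sj; apply: ler_sum => i _.
    by rewrite ler_piMr ?sqr_ge0 // sq_le1.
  move: (\sum_(i in A) _) => P P4 h.
  have : 0 <= (X / 4) ^+ 2 * (4 - P) by rewrite mulr_ge0 ?sqr_ge0 //; lra.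
  by lra.
have X4 : `|X| <= 4.
  by rewrite -(ler_pXn2r (n := 2)) ?nnegrE // real_normK ?num_real //; lra.
have dotn : `|dot| <= n.
  rewrite /n -[#|I|%:R]/(1 *+ #|I|) -sumr_const; apply: le_trans (ler_norm_sum _ _ _) _.
  by apply: ler_sum => i _; rewrite normrM mulr_ile1.
pose a := 64^-1 * dot - 2 / 256 * X; pose b := 256^-1 * B.
have wE t' : weight A (fun i => x i + t' * y i) j = weight A x j * expR (a * t' - b * t' ^+ 2).
  rewrite /weight -expRD; congr expR.
  have -> : dev (fun i => x i + t' * y i) j = dev x j + t' * dot.
    by rewrite /dev /dot mulr_sumr -big_split /=; apply: eq_bigr => i _; ring.
  have -> : energy A (fun i => x i + t' * y i) j = energy A x j - 2 * t' * X - t' ^+ 2 * B.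
    rewrite /energy /X BE !mulr_sumr -!sumrB /=; apply: eq_bigr => i _; ring.
  by rewrite /a /b; field.
have := wE eta; have -> : (fun i => x i - eta * y i) = (fun i => x i + (- eta) * y i).
  by apply/funext => i; rewrite mulNr.
have := wE (- eta); rewrite sqrrN mulrN => -> ->.
have w0 : 0 < weight A x j by exact: expR_gt0.
have an : `|a| * eta <= 1 / 2.
  have : `|a| <= 64^-1 * n + 8 / 256.
    rewrite /a; apply: le_trans (ler_normB _ _) _; rewrite !normrM.
    rewrite (@ger0_norm _ 64^-1) ?(@ger0_norm _ 2) ?(@ger0_norm _ 256^-1); lra.
  move=> h; apply: le_trans (_ : (64^-1 * n + 8 / 256) * eta <= _).
    by rewrite ler_wpM2r // ltW.
  have := eta_n; have : 0 <= n * eta by rewrite mulr_ge0 // ltW.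
  by lra.
have a2 : 2 * a ^+ 2 <= 1024^-1 * dot ^+ 2 + b / 4.
  exact: slope_sq_le.
have b01 : 0 <= b <= 64^-1 by rewrite /b; lra.
rewrite -mulrDr [X in _ <= _ + X]mulrCA [2 * weight _ _ _]mulrC -mulrDr ler_pM2l //.
have -> : 512^-1 * B = b / 2 by rewrite /b; field.
exact: expR_sym_step.
Qed.

(** Move along a balanced direction orthogonal to [x] and to the rows that are not small.
    Orthogonality to [x] fixes the growth of the squared norm; the potentials at the two signs
    average to at most the old one, so one sign works. *)
Let walk_step x : walk_inv x -> (4 <= #|alive x|)%N ->
  exists x', walk_inv x' /\ \sum_i x' i ^+ 2 = \sum_i x i ^+ 2 + eta ^+ 2.
Proof.
move=> [x1 dev0 potx] A4; set A := alive x in dev0 potx A4.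
pose F : finType := ({j | ~~ small A j} + unit)%type.
pose g (s : F) i := match s with inl j => v (val j) i | inr _ => x i end.
pose W j := if small A j then weight A x j else 0.
have W0 j : 0 <= W j by rewrite /W; case: ifP => // _; exact: expR_ge0.
(* At most [#|A| / 4] rows are not small, and [4 <= #|A|] leaves room for the extra constraint
   [x]. *)
have FA : (2 * #|F| <= #|A|)%N.
  by rewrite card_sum card_unit card_sig; have := count_big A; lia.
have [||y [yA y2 yg yW]] := @exists_balanced_direction _ _ A F g J v W _ FA W0.
- by lia.
- move=> i iA; have [j [vji vj]] := singleton_row i.
  have sj : small A j.
    rewrite /small /mass (bigD1 i) //= big1 ?addr0; last first.
      by move=> l /andP[_ /vj->]; rewrite expr0n.
    by apply: le_trans (entry_sq_le1 j i) _; lra.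
  rewrite (bigD1 j) //= ltr_pwDl //.
    by rewrite /W sj mulr_gt0 ?expR_gt0 // exprn_even_gt0.
  by apply: sumr_ge0 => l _; rewrite mulr_ge0 ?sqr_ge0.
have y1 i : `|y i| <= 1.
  rewrite -(ler_pXn2r (n := 2)) ?nnegrE // real_normK ?num_real // expr1n -y2.
  by rewrite (bigD1 i) //= lerDl; apply: sumr_ge0 => l _; exact: sqr_ge0.
have xy : \sum_i x i * y i = 0 by exact: (yg (inr tt)).
have bigj j : ~~ small A j -> \sum_i v j i * y i = 0.
  by move=> bj; exact: (yg (inl (Sub j bj))).
have keep (t : R) : `|t| = eta -> let x' := fun i => x i + t * y i in
    \sum_j pot A x' j <= \sum_j pot A x j ->
    walk_inv x' /\ \sum_i x' i ^+ 2 = \sum_i x i ^+ 2 + eta ^+ 2.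
  move=> te x' potx'.
  have x'1 i : `|x' i| <= 1.
    rewrite /x'; have [|/yA->] := boolP (i \in A); last by rewrite mulr0 addr0.
    rewrite inE => xi; apply: le_trans (ler_normD _ _) _; rewrite normrM te.
    have : eta * `|y i| <= eta by rewrite ler_piMr // ltW.
    by lra.
  have A'A : alive x' \subset A.
    apply/subsetP => i; apply: contraLR => iA.
    by move: (iA); rewrite !inE /x' (yA i iA) mulr0 addr0.
  have dev'0 j : ~~ small A j -> dev x' j = 0.
    move=> bj; have -> : dev x' j = dev x j + t * \sum_i v j i * y i.
      by rewrite /dev mulr_sumr -big_split /=; apply: eq_bigr => i _; rewrite /x'; ring.
    by rewrite bigj // dev0 // mulr0 addr0.
  split; last first.
    have -> : eta ^+ 2 = t ^+ 2 by rewrite -te real_normK ?num_real.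
    transitivity (\sum_i x i ^+ 2 + 2 * t * (\sum_i x i * y i) + t ^+ 2 * \sum_i y i ^+ 2).
      rewrite !mulr_sumr -!big_split /=; apply: eq_bigr => i _; rewrite /x'; ring.
    by rewrite xy y2 mulr0 addr0 mulr1.
  split=> // [j bj|].
    apply: dev'0; apply: contra bj => sA.
    exact: le_trans (mass_subset (v j) A'A) sA.
  apply: le_trans potx; apply: le_trans potx'; apply: ler_sum => j _.
  by apply: pot_subset => // bj; exact: dev'0.
have step : \sum_j pot A (fun i => x i + eta * y i) j + \sum_j pot A (fun i => x i - eta * y i) j
    <= 2 * \sum_j pot A x j.
  rewrite -big_split /=.
  apply: (@le_trans _ _ (\sum_j (2 * pot A x j + 2 * eta ^+ 2 * (W j *
    (1024^-1 * (\sum_i v j i * y i) ^+ 2 - 512^-1 * \sum_i v j i ^+ 2 * y i ^+ 2))))).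
    by apply: ler_sum => j _; apply: (@pot_step A x y j) => //; exact: bigj.
  rewrite big_split /= -!mulr_sumr gerDl mulr_ge0_le0 //.
    by rewrite mulr_ge0 ?sqr_ge0.
  (* By balance the growth is at most [2 / 1024 = 512^-1] times the sum that the loss of energy pays
     for. *)
  have -> : \sum_j W j * (1024^-1 * (\sum_i v j i * y i) ^+ 2 - 512^-1 * \sum_i v j i ^+ 2 * y i ^+ 2)
    = 1024^-1 * (\sum_j W j * (\sum_i v j i * y i) ^+ 2) -
      512^-1 * \sum_j W j * \sum_i v j i ^+ 2 * y i ^+ 2.
    by rewrite !mulr_sumr -sumrB /=; apply: eq_bigr => j _; ring.
  by lra.
have [le1|le2] := leP (\sum_j pot A (fun i => x i + eta * y i) j) (\sum_j pot A x j).
  by exists (fun i => x i + eta * y i); apply: keep => //; rewrite gtr0_norm.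
exists (fun i => x i + (- eta) * y i); apply: keep; first by rewrite normrN gtr0_norm.
have -> : (fun i => x i + (- eta) * y i) = (fun i => x i - eta * y i).
  by apply/funext => i; rewrite mulNr.
by lra.
Qed.

(** One weight is at most the whole potential, so [dev x j <= 64 ln #|J| + 1]. Rounding to the
    nearest sign costs at most [1] for each of at most three alive coordinates and [eta] for each
    other one. *)
Let walk_end x : walk_inv x -> (#|alive x| < 4)%N ->
  exists e : {ffun I -> bool}, forall j,
    \sum_i v j i * (sgb R (e i) - u i) <= 64 * ln (#|J|%:R) + 5.
Proof.
move=> [x1 dev0 potx] A3; exists [ffun i => 0 <= x i] => j.
have J1 : 1 <= #|J|%:R :> R by rewrite ler1n; apply/card_gt0P; exists j.
have lnJ : 0 <= ln #|J|%:R :> R by rewrite ln_ge0.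
have devj : dev x j <= 64 * ln (#|J|%:R) + 1.
  have [sj|/dev0->] := boolP (small (alive x) j); last by lra.
  have : expR (64^-1 * dev x j) <= expR (ln #|J|%:R + 64^-1).
    rewrite expRD lnK ?posrE ?(lt_le_trans ltr01) //.
    apply: le_trans potx; rewrite (bigD1 j) //= /pot sj.
    have /andP[en0 _] := energy_le (alive x) j x1.
    apply: le_trans (_ : weight (alive x) x j <= _); first by rewrite ler_expR; lra.
    rewrite lerDl; apply: sumr_ge0 => l _; case: ifP => _; exact: expR_ge0.
  by rewrite ler_expR; lra.
have -> : \sum_i v j i * (sgb R ([ffun i => 0 <= x i] i) - u i) =
    dev x j + \sum_i v j i * (sgb R (0 <= x i) - x i).
  by rewrite /dev -big_split /=; apply: eq_bigr => i _; rewrite ffunE; ring.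
suff : \sum_i v j i * (sgb R (0 <= x i) - x i) <= 4 by lra.
have rnd i : `|sgb R (0 <= x i) - x i| = 1 - `|x i|.
  have := x1 i; rewrite /sgb; case: (leP 0 (x i)) => xi.
    by rewrite (ger0_norm xi) => ?; rewrite ger0_norm //; lra.
  by rewrite (ltr0_norm xi) => ?; rewrite ler0_norm; lra.
apply: (@le_trans _ _ (\sum_i ((i \in alive x)%:R + eta))).
  apply: ler_sum => i _; apply: le_trans (ler_norm _) _.
  rewrite normrM rnd; apply: le_trans (_ : 1 - `|x i| <= _).
    by rewrite ler_piMl // subr_ge0.
  rewrite inE; case: ltP => /= h; last by lra.
  by have := normr_ge0 (x i); have := eta_gt0; lra.
rewrite big_split /= sumr_const -[eta *+ _]mulr_natr -/n -natr_sum.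
have -> : (\sum_i (i \in alive x) = #|alive x|)%N.
  by rewrite -sum1_card [RHS]big_mkcond; apply: eq_bigr => i _; case: (i \in _).
have : #|alive x|%:R <= 3 :> R by rewrite ler_nat.
by have := eta_n; have := eta_gt0; lra.
Qed.

(** Start at [u], where all deviations vanish. The squared norm gains [eta ^+ 2] per step and never
    exceeds [n], so at most [n * (n + 1)^2] steps occur. *)
Lemma one_sided_discrepancy :
  exists e : {ffun I -> bool}, forall j,
    \sum_i v j i * (sgb R (e i) - u i) <= 64 * ln (#|J|%:R) + 5.
Proof.
suff H N x : walk_inv x -> n - \sum_i x i ^+ 2 <= N%:R * eta ^+ 2 ->
  exists e : {ffun I -> bool}, forall j,
    \sum_i v j i * (sgb R (e i) - u i) <= 64 * ln (#|J|%:R) + 5.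
  have d0 j : dev u j = 0 by rewrite /dev big1 // => i _; rewrite subrr mulr0.
  apply: (H (#|I| * #|I|.+1 ^ 2)%N u).
    split=> //; rewrite mulr_natl -sumr_const; apply: ler_sum => j _.
    rewrite /pot; case: ifP => // sj; rewrite /weight ler_expR d0.
    by have /andP[_] := energy_le (alive u) j u_le1; move: sj; rewrite /small; lra.
  have -> : (#|I| * #|I|.+1 ^ 2)%:R * eta ^+ 2 = n.
    rewrite natrM natrX -[#|I|.+1]addn1 natrD -/n -mulrA -exprMn [(n + 1) * _]mulrC eta_n.
    by rewrite expr1n mulr1.
  by rewrite lerBlDr lerDl; apply: sumr_ge0 => i _; exact: sqr_ge0.
elim: N x => [|N IH] x xP xN; have [A4|] := ltnP #|alive x| 4; try exact: walk_end xP A4.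
  move=> /(walk_step xP)[x' [[x'1 _ _] x'2]].
  have : \sum_i x' i ^+ 2 <= n.
    rewrite /n -[#|I|%:R]/(1 *+ #|I|) -sumr_const; apply: ler_sum => i _; exact: sq_le1.
  have : 0 < eta ^+ 2 by rewrite exprn_gt0.
  by move: xN; rewrite mul0r x'2; lra.
move=> /(walk_step xP)[x' [x'P x'2]]; apply: (IH x' x'P).
by move: xN; rewrite x'2 -[N.+1]addn1 natrD mulrDl mul1r; lra.
Qed.

End Walk.

(** The rows [v j / 2] and [- v j / 2] make the bound two-sided, and rows with a single entry
    [1 / 2] serve as singleton rows; column square sums stay at most [1/2 + 1/4]. *)
Lemma discrepancy (I J : finType) (v : J -> I -> R) (u : I -> R) :
  (forall i, \sum_j v j i ^+ 2 <= 1) -> (forall i, `|u i| <= 1) ->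
  exists e : {ffun I -> bool}, forall j,
    `|\sum_i v j i * (sgb R (e i) - u i)| <= 128 * ln (2 * #|J|%:R + #|I|%:R) + 10.
Proof.
move=> col u1.
pose v' (s : J * bool + I) i : R :=
  match s with inl jb => sgb R jb.2 / 2 * v jb.1 i | inr l => if i == l then 1 / 2 else 0 end.
have [i|i||e eP] := @one_sided_discrepancy I (J * bool + I)%type v' u.
- rewrite big_sumType /= -(pair_bigA _ (fun j b => (sgb R b / 2 * v j i) ^+ 2)) /=.
  rewrite [X in _ + X](bigD1 i) //= eqxx [X in _ + (_ + X)]big1 => [|l /negPf il]; last first.
    by rewrite eq_sym il expr0n.
  have := col i; set c := \sum_j _ => c1.
  have -> : \sum_j \sum_b (sgb R b / 2 * v j i) ^+ 2 = 1 / 2 * c.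
    by rewrite mulr_sumr; apply: eq_bigr => j _; rewrite big_bool /sgb /=; field.
  by lra.
- exists (inr i); rewrite /v' eqxx; split; first by apply/negP => /eqP; lra.
  by move=> l /negPf ->.
- exact: u1.
exists e => j; rewrite card_sum card_prod card_bool natrD natrM in eP.
have [ep en] := (eP (inl (j, true)), eP (inl (j, false))).
rewrite /v' /sgb /= in ep en.
set s := \sum_i _.
have ep' : 1 / 2 * s <= 64 * ln (#|J|%:R * 2 + #|I|%:R) + 5.
  apply: le_trans ep; rewrite mulr_sumr le_eqVlt; apply/orP; left; apply/eqP.
  by apply: eq_bigr => i _; rewrite mulrA.
have en' : - 1 / 2 * s <= 64 * ln (#|J|%:R * 2 + #|I|%:R) + 5.
  apply: le_trans en; rewrite mulr_sumr le_eqVlt; apply/orP; left; apply/eqP.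
  by apply: eq_bigr => i _; rewrite mulrA.
by rewrite ler_norml [2 * _]mulrC; lra.
Qed.

End Discrepancy.

(** * The undissected edge *)

Section Assembly.
Variable R : realType.

Lemma sum_sqr_le (J : finType) (a : J -> R) :
  (\sum_j a j) ^+ 2 <= #|J|%:R * \sum_j a j ^+ 2.
Proof.
set s := \sum_j a j; set q := \sum_j _; set k : R := #|J|%:R.
have [J0|k0] := leqP #|J| 0.
  by rewrite /k /s (eq_card0 _) ?mul0r; last first; rewrite ?big_pred0 ?expr0n // => j;
    move: J0; rewrite leqn0 => /eqP/card0_eq/(_ j).
have {}k0 : 0 < k by rewrite ltr0n.
have : 0 <= \sum_j (k * a j - s) ^+ 2 by apply: sumr_ge0 => j _; exact: sqr_ge0.
have -> : \sum_j (k * a j - s) ^+ 2 = k * (k * q - s ^+ 2).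
  transitivity (k ^+ 2 * q - 2 * k * s * s + \sum_(j : J) s ^+ 2).
    have -> : 2 * k * s * s = \sum_j 2 * k * s * a j by rewrite -mulr_sumr.
    rewrite mulr_sumr -sumrB -big_split /=; apply: eq_bigr => j _.
    by move: (k) (s) => k' s'; ring.
  by rewrite sumr_const -[_ *+ #|J|]mulr_natr -/k; ring.
by rewrite pmulr_rge0 // subr_ge0.
Qed.

Lemma entry_le_mass (I : finType) (v : I -> R) (S : {set I}) i :
  i \in S -> `|v i| <= Num.sqrt (mass v S).
Proof.
move=> iS; rewrite -(ler_pXn2r (n := 2)) ?nnegrE ?sqrtr_ge0 // sqr_sqrtr ?mass_ge0 //.
rewrite real_normK ?num_real // /mass (bigD1 i) //= lerDl.
by apply: sumr_ge0 => l _; exact: sqr_ge0.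
Qed.

Lemma walk_mix (I : finType) (v : I -> R) (B G : {set I}) (x y : {ffun I -> bool}) :
  [disjoint B & G] -> walk v B (mix G x y) = walk v B x.
Proof.
move=> /pred0P BG; apply: eq_bigr => i iB; rewrite ffunE.
by have := BG i; rewrite /= iB /= => ->.
Qed.

Lemma walkC (I : finType) (v : I -> R) (G : {set I}) (x : {ffun I -> bool}) :
  \sum_i v i * sgb R (x i) = walk v (~: G) x + walk v G x.
Proof.
rewrite addrC /walk (bigID (mem G)) /=; congr (_ + _).
by apply: eq_bigl => i; rewrite inE.
Qed.

(** With [r] the root of the mass on [S], the signs on [S] contribute at most [n * r]; the margin
    leaves [2 * r], and [|v i| <= r]. *)
Lemma far_row (n : nat) (v : 'I_n -> R) (b : R) (G S : {set 'I_n}) x y i :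
  i \in G -> G \subset S ->
  (n%:R + 2) * Num.sqrt (mass v S) < `|walk v (~: S) x - b| ->
  2 * `|v i| <= `|\sum_l v l * sgb R (mix G x y l) - b|.
Proof.
move=> iG GS far; set r := Num.sqrt _ in far.
have vr l : l \in S -> `|v l| <= r by exact: entry_le_mass.
rewrite (walkC _ S) walk_mix; last by rewrite disjoints_subset setCS.
set rest := walk v S _; have rest_le : `|rest| <= n%:R * r.
  apply: le_trans (ler_norm_sum _ _ _) _.
  apply: (@le_trans _ _ (\sum_(l in S) r)).
    by apply: ler_sum => l lS; rewrite normrM normr_sgb mulr1 vr.
  rewrite sumr_const -[r *+ _]mulr_natl ler_wpM2r ?sqrtr_ge0 // ler_nat.
  by rewrite (leq_trans (max_card _)) ?card_ord.
have := vr i (subsetP GS i iG); rewrite addrAC; have := ler_normB (walk v (~: S) x - b + rest) rest.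
by rewrite addrK; lra.
Qed.

Lemma rounding_parameters (n : nat) : (4 <= n)%N -> 1 <= ln n%:R :> R ->
  exists T : nat, T.+1%:R <= 22 * ln n%:R :> R /\ n%:R * ((n%:R + 2) * (4 / 5) ^+ T) < 1 :> R.
Proof.
move=> n4 L1; set L := ln _ in L1 *.
have e2 : 3 <= expR 2 :> R by have := expR_ge1Dx (2 : R); lra.
have n0 : 0 < n%:R :> R by rewrite ltr0n; lia.
have n4R : 4 <= n%:R :> R by rewrite ler_nat.
(* [T > 10 L + 10] gives [(4 / 5)^T <= expR (- 2 L - 2)], which beats [n (n + 2)]; and
   [T + 1 <= 10 L + 12 <= 22 L]. *)
pose T := (Num.truncn (10 * L) + 11)%N.
have /andP[T1 T2] : (Num.truncn (10 * L))%:R <= 10 * L < (Num.truncn (10 * L)).+1%:R.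
  by apply: Num.Theory.truncn_itv; lra.
exists T; split; first by rewrite /T -addnS natrD; lra.
have powT : (4 / 5) ^+ T <= expR (- 2 * L - 2).
  apply: (@le_trans _ _ (expR (- (1 / 5)) ^+ T)).
    apply: lerXn2r; rewrite ?nnegrE ?expR_ge0 //.
    by have := expR_ge1Dx (- (1 / 5) : R); lra.
  rewrite -expRM_natl ler_expR -mulr_natl /T natrD.
  by move: T2; rewrite -addn1 natrD; lra.
rewrite mulrA; apply: (@le_lt_trans _ _ (n%:R * (n%:R + 2) * expR (- 2 * L - 2))).
  by apply: ler_wpM2l powT; rewrite mulr_ge0 //; lra.
have -> : expR (- 2 * L - 2) = (n%:R ^+ 2 * expR 2)^-1.
  rewrite expRB mulNr expRN invfM; congr (_^-1 * _).
  by rewrite expRM_natl lnK ?posrE.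
rewrite ltr_pdivrMr ?mul1r; last by rewrite mulr_gt0 ?exprn_gt0 ?expR_gt0.
apply: (@lt_le_trans _ _ (n%:R ^+ 2 * 3)); last by rewrite ler_pM2l ?exprn_gt0.
by rewrite expr2 -[ltRHS]mulrA ltr_pM2l //; clear -n4R; lra.
Qed.

Lemma exists_far_vertex (n k : nat) (v : 'I_k -> 'I_n -> R) (b : 'I_k -> R) :
  (4 <= n)%N -> 1 <= ln n%:R :> R -> (forall j, 0 < mass (v j) setT) ->
  (2 * 22 * 268 * 250 ^+ 2) ^+ 2 * (k%:R ^+ 3 * ln n%:R ^+ 4) <= n%:R ^+ 2 :> R ->
  exists (e : {ffun 'I_n -> bool}) (i : 'I_n), forall j,
    2 * `|v j i| <= `|\sum_l v j l * sgb R (e l) - b j|.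
Proof.
move=> n4 L1 v0 kn; set L := ln _ in L1 kn.
have n0 : 0 < n%:R :> R by rewrite ltr0n; lia.
have [k0|k_gt0] := posnP k.
  have n_gt0 : (0 < n)%N by lia.
  by exists [ffun=> true], (Ordinal n_gt0) => j; have := ltn_ord j; rewrite {2}k0.
have k0 : 0 < k%:R :> R by rewrite ltr0n.
have L0 : 0 < L by lra.
pose K : R := 2 * 22 * 268 * 250 ^+ 2.
have K1 : 1 <= K by rewrite /K; lra.
have k_le_n : k%:R <= n%:R :> R.
  have k1 : 1 <= k%:R :> R by rewrite ler1n.
  rewrite -(ler_pXn2r (n := 2)) ?nnegrE ?ler0n //; apply: le_trans kn.
  apply: (@le_trans _ _ (k%:R ^+ 3)); first by rewrite ler_weXn2l.
  apply: (@le_trans _ _ (k%:R ^+ 3 * L ^+ 4)).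
    by rewrite ler_peMr ?exprn_ge0 ?ler0n // exprn_ege1.
  by rewrite ler_peMl ?mulr_ge0 ?exprn_ge0 ?ler0n ?(ltW L0) // exprn_ege1.
have [T [T22 Tsmall]] := rounding_parameters n4 L1; rewrite -/L in T22.
(* The factor [2] limits the deletions to [n / 2] columns, so [G] is nonempty. *)
pose tau : R := 2 * k%:R * T.+1%:R / n%:R.
have tau0 : 0 < tau by rewrite !(mulr_gt0, invr_gt0) // ltr0n.
have tauE : tau = 2 * k%:R * T.+1%:R / n%:R by [].
clearbody tau.
have [G [p [S [resc col row]]]] := exists_rescaled T tau v0.
have [chain GS _ _] := resc.
have [i iG] : exists i, i \in G.
  apply/set0Pn; apply/eqP => G0; have := rescaled_card resc.
  rewrite G0 setC0 cardsT !card_ord tauE mulfVK ?gt_eqF //.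
  have : 0 < k%:R * T.+1%:R :> R by rewrite mulr_gt0 // ltr0n.
  by lra.
have [|||x0 x0P] := @exists_signs_far R 'I_n 'I_k v b (fun j => p j == T) T S (n%:R + 2).
- by move=> j /eqP <-.
- by lra.
- apply: le_lt_trans Tsmall; rewrite card_ord; apply: ler_wpM2r k_le_n.
  by rewrite mulr_ge0 ?addr_ge0 ?exprn_ge0 ?divr_ge0 ?ler0n.
pose light j := mass (v j) (S j) <= 250 ^+ 2 * mass (v j) G.
pose c j := Num.sqrt (mass (v j) (S j) * tau).
have S0 j : 0 < mass (v j) (S j) by exact: mass_chain_gt0 (chain j).
have c0 j : 0 < c j by rewrite sqrtr_gt0 mulr_gt0.
have c2 j : c j ^+ 2 = mass (v j) (S j) * tau by rewrite sqr_sqrtr // mulr_ge0 ?ltW.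
pose w j l := if light j && (l \in G) then v j l / c j else 0.
have wcol l : \sum_j w j l ^+ 2 <= 1.
  have [lG|lG] := boolP (l \in G); last first.
    by rewrite big1 // => j _; rewrite /w (negPf lG) andbF expr0n.
  rewrite -[leRHS](divff (lt0r_neq0 tau0)) ler_pdivlMr //; apply: le_trans (col l lG).
  rewrite mulr_suml; apply: ler_sum => j _; rewrite /w lG andbT; case: ifP => _.
    by rewrite expr_div_n c2 invfM mulrA mulfVK ?gt_eqF.
  by rewrite expr0n /= mul0r divr_ge0 ?sqr_ge0 ?ltW.
(* [268 L] covers the rounding cost [256 L + 10] plus a margin [2]. A light row has
   [|w_j|^2 >= 1 / (250 ^+ 2 * tau)], so [theta] makes Bang's gap at least [Q]. *)
pose Q : R := 268 * L; pose theta := tau * Q * 250 ^+ 2.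
have Q0 : 0 < Q by rewrite /Q; lra.
have theta0 : 0 < theta by apply: mulr_gt0; [exact: mulr_gt0|rewrite exprn_gt0].
(* [theta] is of order at most [k L^2 / n], so this is where the bound on [k^3 L^4] enters; it keeps
   Bang's point in the cube. *)
have theta1 : theta ^+ 2 * k%:R <= 1.
  have -> : theta = 2 * 268 * 250 ^+ 2 * (T.+1%:R * L * k%:R) / n%:R.
    by rewrite /theta tauE /Q; field; rewrite gt_eqF.
  rewrite expr_div_n mulrAC ler_pdivrMr ?exprn_gt0 // mul1r; apply: le_trans kn.
  have -> : (2 * 268 * 250 ^+ 2 * (T.+1%:R * L * k%:R)) ^+ 2 * k%:R =
    (2 * 268 * 250 ^+ 2) ^+ 2 * (k%:R ^+ 3 * L ^+ 2) * T.+1%:R ^+ 2 :> R by ring.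
  have -> : (2 * 22 * 268 * 250 ^+ 2) ^+ 2 * (k%:R ^+ 3 * L ^+ 4) =
    (2 * 268 * 250 ^+ 2) ^+ 2 * (k%:R ^+ 3 * L ^+ 2) * (22 * L) ^+ 2 :> R by ring.
  apply: ler_wpM2l.
    apply: mulr_ge0; first exact: sqr_ge0.
    by rewrite mulr_ge0 ?sqr_ge0 // exprn_ge0 // ltW.
  by rewrite lerXn2r // nnegrE ?ler0n //; lra.
pose b' j := (b j - walk (v j) (~: G) x0) / c j.
have [eps epsP] := Bang w b' theta0.
pose u l := theta * \sum_j sgb R (eps j) * w j l.
have u1 l : `|u l| <= 1.
  rewrite -(ler_pXn2r (n := 2)) ?nnegrE // real_normK ?num_real // expr1n /u exprMn.
  apply: le_trans theta1; apply: ler_wpM2l; first exact: sqr_ge0.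
  apply: le_trans (sum_sqr_le _) _; rewrite card_ord -[leRHS]mulr1; apply: ler_wpM2l; first exact: ltW.
  by apply: le_trans (wcol l); apply: ler_sum => j _; rewrite exprMn sgb_sqr mul1r.
have [y yP] := discrepancy wcol u1.
have D_le : 128 * ln (2 * k%:R + n%:R) + 10 <= Q - 2.
  suff : ln (2 * k%:R + n%:R) <= 2 * L by rewrite /Q; lra.
  have -> : 2 * L = ln (n%:R ^+ 2) by rewrite lnXn // mulr_natl.
  rewrite ler_ln ?posrE ?exprn_gt0 //; last by lra.
  have : 4 <= n%:R :> R by rewrite ler_nat.
  by nra.
(* Rows rescaled [T] times are far by the choice of [x0]; rows without mass on [G] have [v j i = 0];
   light rows remain. *)
exists (mix G x0 y), i => j; have [pT|G0|lj] := row j.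
- by apply: far_row iG (GS j) _; apply: x0P; rewrite pT.
- suff -> : v j i = 0 by rewrite normr0 mulr0.
  by apply/eqP; rewrite -normr_le0; have := entry_le_mass (v j) iG; rewrite G0 sqrtr0.
have wE l : l \in G -> w j l = v j l / c j by move=> lG; rewrite /w /light lj lG.
have wN l : l \notin G -> w j l = 0 by move=> /negPf lG; rewrite /w lG andbF.
have w_le1 : `|w j i| <= 1.
  rewrite -(ler_pXn2r (n := 2)) ?nnegrE // real_normK ?num_real // expr1n.
  apply: le_trans (wcol i); rewrite (bigD1 j) //= lerDl.
  by apply: sumr_ge0 => l _; exact: sqr_ge0.
have massw : Q <= theta * mass (w j) setT.
  have -> : mass (w j) setT = mass (v j) G / (mass (v j) (S j) * tau).
    rewrite massT (bigID (mem G)) /= [X in _ + X]big1 ?addr0; last first.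
      by move=> l lG; rewrite wN // expr0n.
    by rewrite /mass mulr_suml; apply: eq_bigr => l lG; rewrite wE // expr_div_n c2.
  rewrite mulrA ler_pdivlMr ?mulr_gt0 //.
  have -> : theta * mass (v j) G = Q * tau * (250 ^+ 2 * mass (v j) G) by rewrite /theta; ring.
  by rewrite mulrA mulrAC; apply: ler_wpM2l lj; rewrite mulr_ge0 // ltW.
have wy : \sum_l w j l * sgb R (y l) - b' j =
    (\sum_l v j l * sgb R (mix G x0 y l) - b j) / c j.
  rewrite (walkC (v j) G (mix G x0 y)) [walk _ (~: G) _]walk_mix; last first.
    by rewrite disjoints_subset subxx.
  have -> : \sum_l w j l * sgb R (y l) = walk (v j) G (mix G x0 y) / c j.
    rewrite (bigID (mem G)) /= [X in _ + X]big1 ?addr0; last first.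
      by move=> l lG; rewrite wN // mul0r.
    by rewrite /walk mulr_suml; apply: eq_bigr => l lG; rewrite wE // ffunE lG mulrAC.
  by rewrite /b'; ring.
have : 2 <= `|\sum_l w j l * sgb R (y l) - b' j|.
  have yj := yP j; rewrite !card_ord in yj.
  have ej := epsP j; rewrite -/(u _) in ej.
  have := le_trans massw ej.
  have -> : \sum_l w j l * (theta * \sum_j sgb R (eps j) * w j l) - b' j =
     (\sum_l w j l * sgb R (y l) - b' j) - \sum_l w j l * (sgb R (y l) - u l).
    rewrite addrAC; congr (_ - _).
    by rewrite -sumrB; apply: eq_bigr => l _; rewrite /u; ring.
  move=> /le_trans/(_ (ler_normB _ _)); lra.
rewrite wy normrM normfV (gtr0_norm (c0 j)) ler_pdivlMr // => h; apply: le_trans h.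
rewrite ler_pM2l //; move: w_le1; rewrite wE // normrM normfV (gtr0_norm (c0 j)).
by rewrite ler_pdivrMr // mul1r.
Qed.

(** Along the edge the form runs from [s - b] to [s - b - 2 a_i x_i]. A zero at [t] gives
    [|s - b| = 2 t |a_i|]; if [x] is off the hyperplane then [a_i] is nonzero, so [t = 1] and [y]
    lies on it. *)
Lemma far_vertex_undissected (n k : nat) (h : 'I_k -> set 'rV[R]_n) (a : 'I_k -> 'rV[R]_n)
    (b : 'I_k -> R) (e : {ffun 'I_n -> bool}) (i : 'I_n) :
  (forall j, h j = [set x | \sum_(l < n) a j 0 l * x 0 l = b j]%classic) ->
  (forall j, 2 * `|a j 0 i| <= `|\sum_l a j 0 l * sgb R (e l) - b j|) ->
  exists x y, cube_edge x y /\ forall j, ~ dissects (h j) x y.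
Proof.
move=> hE far; pose x : 'rV[R]_n := \row_l sgb R (e l).
pose y : 'rV[R]_n := \row_l sgb R (flip i e l).
have vert (f : {ffun 'I_n -> bool}) : cube_vertex (\row_l sgb R (f l)).
  by move=> l; rewrite mxE /sgb; case: (f l); [right|left].
have yE l : y 0 l = x 0 l - (if l == i then 2 * x 0 i else 0).
  rewrite !mxE ffunE; case: eqVneq => [->|_] /=; last by rewrite subr0.
  by rewrite sgbN; ring.
exists x, y; split.
  split; [exact: vert|exact: vert|].
  rewrite (bigD1 i) //= big1 => [|l /negPf li]; last by rewrite yE li subr0 subrr normr0.
  have -> : x 0 i - y 0 i = 2 * x 0 i by rewrite yE eqxx; ring.
  by rewrite normrM [x 0 i]mxE normr_sgb addr0 mulr1 ger0_norm.
move=> j [[z []]]; rewrite hE /= => zP [t /andP[t0 t1] zE] xP yP.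
have := far j; set s := \sum_l a j 0 l * sgb R (e l).
have sx : \sum_l a j 0 l * x 0 l = s by apply: eq_bigr => l _; rewrite mxE.
have sy : \sum_l a j 0 l * y 0 l = s - 2 * (a j 0 i * x 0 i).
  rewrite -sx (bigD1 i) //= [in RHS](bigD1 i) //= yE eqxx.
  rewrite [in LHS](eq_bigr (fun l => a j 0 l * x 0 l)); last first.
    by move=> l /negPf li; rewrite yE li subr0.
  by ring.
have sz : \sum_l a j 0 l * z 0 l = (s - b j) - 2 * t * (a j 0 i * x 0 i) + b j.
  transitivity ((1 - t) * \sum_l a j 0 l * x 0 l + t * \sum_l a j 0 l * y 0 l).
    rewrite !mulr_sumr -big_split /=; apply: eq_bigr => l _.
    by rewrite zE !mxE; ring.
  by rewrite sx sy; ring.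
move: xP yP zP; rewrite sx sy sz => xP yP zP.
have sbE : s - b j = 2 * t * (a j 0 i * x 0 i) by lra.
rewrite sbE !normrM (ger0_norm t0) (ger0_norm (ler0n _ 2)) [x 0 i]mxE normr_sgb mulr1.
rewrite -mulrA ler_pM2l // => ha.
have ax0 : a j 0 i != 0.
  by apply/eqP => a0; apply: xP; move: sbE; rewrite a0 mul0r mulr0; lra.
have : 1 <= t by rewrite -(ler_pM2r (_ : 0 < `|a j 0 i|)) ?normr_gt0 // mul1r.
move=> t1'; have tE : t = 1 by lra.
by apply: yP; move: sbE; rewrite tE; lra.
Qed.

Lemma not_dissectable (n k : nat) : (4 <= n)%N -> 1 <= ln n%:R :> R ->
  (2 * 22 * 268 * 250 ^+ 2) ^+ 2 * (k%:R ^+ 3 * ln n%:R ^+ 4) <= n%:R ^+ 2 :> R ->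
  ~ dissectable_by R n k.
Proof.
move=> n4 L1 kn [h [hP hcover]].
have /choice[ab abP] j : exists ab : 'rV[R]_n * R, ab.1 != 0 /\
    h j = [set x | \sum_(l < n) ab.1 0 l * x 0 l = ab.2]%classic.
  by have [a [b abP]] := hP j; exists (a, b).
pose v j l := (ab j).1 0 l.
have v0 j : 0 < mass (v j) setT.
  have [a0 _] := abP j; rewrite lt_def mass_ge0 andbT massT; apply: contra a0.
  rewrite psumr_eq0 => [/allP v0|l _]; last exact: sqr_ge0.
  apply/eqP/rowP => l; rewrite mxE; apply/eqP.
  by have := v0 l (mem_index_enum _); rewrite sqrf_eq0.
have [e [i far]] := exists_far_vertex (fun j => (ab j).2) n4 L1 v0 kn.
have [|x [y [xy ndis]]]
  := @far_vertex_undissected n k h (fun j => (ab j).1) (fun j => (ab j).2) e i _ far.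
  by move=> j; have [_] := abP j.
by have [j /ndis] := hcover x y xy.
Qed.

End Assembly.

Theorem theorem1 (R : realType) :
  exists c : R, 0 < c /\
    exists N : nat, forall n : nat, (N <= n)%N ->
      c * (n%:R `^ (2 / 3) / (ln n%:R) `^ (4 / 3)) <= (H R n)%:R.
Proof.
pose K : R := 2 * 22 * 268 * 250 ^+ 2.
have K1 : 1 <= K by rewrite /K; lra.
have K0 : 0 < K by lra.
exists K^-1; split; first by rewrite invr_gt0.
exists (Num.truncn (expR 1 : R) + 4)%N => n Nn.
have n4 : (4 <= n)%N by lia.
have n0 : 0 < n%:R :> R by rewrite ltr0n; lia.
have L1 : 1 <= ln n%:R :> R.
  rewrite -[leLHS]expRK ler_ln ?posrE ?expR_gt0 //.
  apply: le_trans (ltW (Num.Theory.truncnS_gt _)) _; rewrite ler_nat.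
  by apply: leq_trans Nn; rewrite -addn1 leq_add2l.
set L := ln _ in L1 *; have L0 : 0 < L by lra.
rewrite leNgt; apply/negP => Hlt.
rewrite /H in Hlt; case: ex_minnP Hlt => k /asboolP kdis _ Hlt.
apply: (not_dissectable n4 L1 _ kdis); rewrite -/K -/L.
set A := _ `^ (2 / 3) / _ in Hlt.
have cube (a r : R) : 0 < a -> (a `^ (r / 3)) ^+ 3 = a `^ r.
  by move=> a0; rewrite -powR_mulrn ?powR_ge0 // -powRrM mulfVK.
(* Cubing clears the fractional exponents: [k < A / K] yields [K^3 k^3 L^4 <= n^2], and
   [K^2 <= K^3]. *)
have A3 : A ^+ 3 * L ^+ 4 = n%:R ^+ 2.
  rewrite expr_div_n !cube // !powR_mulrn ?ltW // mulfVK //.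
  by rewrite gt_eqF // exprn_gt0.
have k3 : K ^+ 3 * k%:R ^+ 3 <= A ^+ 3.
  rewrite -exprMn lerXn2r ?nnegrE ?mulr_ge0 ?invr_ge0 ?powR_ge0 ?ler0n ?(ltW K0) //.
  by move: (ltW Hlt); rewrite mulrC ler_pdivlMr // mulrC.
rewrite -A3 mulrA ler_wpM2r ?exprn_ge0 ?(ltW L0) //.
apply: le_trans k3; rewrite ler_wpM2r ?exprn_ge0 //.
by rewrite [leRHS]exprS ler_peMl // exprn_ge0 // ltW.
Qed.
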